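(* For $\frac{\pi}{2}\le\Theta<\pi$ the complexity of the $\Theta$-region is $O(n)$. That is, there is a constant $K$ such that for every $n\ge1$, every set $G\subset\mathbb{R}^2$ of $n$ points (guards) and every $\Theta$ with $\frac{\pi}{2}\le\Theta<\pi$, the complexity of the $\Theta$-region of $G$ is at most $Kn$.
   Context: A $\Theta$-cone is a planar cone (region between two rays from a common apex) with apex angle $\Theta$; cones are considered as open sets. A $\Theta$-cone is empty (with respect to $G$) if it contains no point of $G$. A point $p\in\mathbb{R}^2$ is $\Theta$-guarded if every $\Theta$-cone with apex $p$ is non-empty. The $\Theta$-region is the set of all $\Theta$-guarded points. For $0<\Theta<\pi$ its boundary is composed of finitely many circular arcs. The complexity of the $\Theta$-region is its combinatorial complexity, i.e. the total number of vertices and circular arcs (edges) forming its boundary. *)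

(* Defs.v *)
From mathcomp Require Import all_boot all_order all_algebra.
From mathcomp Require Import finmap.
From mathcomp Require Import all_classical all_reals all_analysis.

Set Implicit Arguments.
Unset Strict Implicit.
Unset Printing Implicit Defensive.

Import Order.TTheory GRing.Theory Num.Theory.
Import numFieldNormedType.Exports.

Local Open Scope classical_set_scope.
Local Open Scope ring_scope.

(* Open cone with apex p and apex angle Theta; phi is the direction of its
   clockwise-most bounding ray.  The apex is not in the cone, so a guard does
   not help to guard its own position. *)
Definition cone (R : realType) (Theta : R) (p : R * R) (phi : R) :
    set (R * R) :=
  [set q | exists r t : R, [/\ 0 < r, phi < t < phi + Theta
                             & q = (p.1 + r * cos t, p.2 + r * sin t)]].

Definition guarded (R : realType) (G : {fset (R * R)}) (Theta : R)
    (p : R * R) : Prop :=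
  forall phi : R, exists2 g, g \in G & cone Theta p phi g.

Definition theta_region (R : realType) (G : {fset (R * R)}) (Theta : R) :
    set (R * R) :=
  [set p | guarded G Theta p].

Definition boundary (T : topologicalType) (A : set T) : set T :=
  closure A `\` interior A.

Definition circle (R : realType) (c : R * R) (r : R) : set (R * R) :=
  [set q | (q.1 - c.1) ^+ 2 + (q.2 - c.2) ^+ 2 = r ^+ 2].

(* p lies in the relative interior of a circular arc of the boundary of A:
   near p that boundary is exactly a circle. *)
Definition arc_point (R : realType) (A : set (R * R)) (p : R * R) : Prop :=
  boundary A p /\
  exists (c : R * R) (r : R),
    0 < r /\ \forall q \near p, boundary A q <-> circle c r q.

Definition vertices (R : realType) (A : set (R * R)) : set (R * R) :=
  [set p | boundary A p /\ ~ arc_point A p].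

(* The circle through an arc point is locally constant along [arc_point A], so
   each connected component is an open arc of a single circle (or a whole
   circle): these are the maximal circular arcs of the boundary of A. *)
Definition edges (R : realType) (A : set (R * R)) : set (set (R * R)) :=
  [set connected_component [set q | arc_point A q] p
    | p in [set q | arc_point A q]].

(* The value is +oo when there are infinitely many vertices or edges; in
   particular, a boundary point at which the boundary is not locally a circular
   arc (e.g. on a line segment) is always charged as a vertex. *)
Definition complexity (R : realType) (A : set (R * R)) : \bar R :=
  (counting (vertices A) + counting (edges A))%E.

(* Main.v *)
Require Import Defs.
From mathcomp Require Import all_boot all_order all_algebra.
From mathcomp Require Import finmap.
From mathcomp Require Import all_classical all_reals all_analysis.
From mathcomp Require Import zify ring lra.
Import Order.TTheory GRing.Theory Num.Theory.
Import numFieldNormedType.Exports.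
Local Open Scope ring_scope.

(** Call a boundary point p outside G generic if exactly one Theta-cone at p is
    empty and each bounding ray of that cone carries exactly one guard.  If
    these guards are h (clockwise side) and g, the boundary near p is the circle
    of the points seeing the pair (h, g) under the angle Theta.  So vertices are
    guards or non-generic points, and it remains to count non-generic points
    and the ends of generic arcs.

    Rotating the cone while it keeps touching g and h moves its apex along that
    circle, until a third guard obstructs it or g and h line up.  At that moment
    some guard is the apex of an empty cone with a further guard on one of its
    rays; since Theta >= pi/2, this happens for at most four directions per
    guard and per side, so there are O(n) such circular arcs.  The same argument
    bounds the points with two guards on one ray of an empty cone.

    Every other non-generic point e has two empty cones.  They leave two closed
    wedges at e; let L(e) be the set of the guards in the wedge that misses a
    fixed guard.  Directions from different wedges form angles >= Theta >= pi/2,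
    so their scalar products are non-positive; this makes the sets L(e) laminar,
    and linearly orders the e whose L(e) contains a given guard.  Along this
    order each circular arc occupies an interval, so the successor of e lies on
    the same two arcs as e except for O(n) points e; and two different circles
    have at most two common points.  Hence there are O(n) such points. *)

Set Implicit Arguments.
Unset Strict Implicit.
Unset Printing Implicit Defensive.

Local Open Scope classical_set_scope.

Ltac slra := repeat match goal with H : is_true (_ && _) |- _ =>
  case/andP: H => ? ? end;
  first [apply/andP; split; lra | lra].

(** * Directions and rays *)

Section Trig.
Variable R : realType.
Implicit Types x y t : R.

Lemma sin2pi_shift x : sin (x + 2 * pi) = sin x.
Proof. by rewrite mulr_natl sinD2pi. Qed.

Lemma cos2pi_shift x : cos (x + 2 * pi) = cos x.
Proof. by rewrite mulr_natl cosD2pi. Qed.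

Lemma sin_le0_2pi x : pi <= x <= 2 * pi -> sin x <= 0.
Proof.
move=> h; have := @sin_ge0_pi R (x - pi); rewrite sinB cospi sinpi mulr0 subr0.
move=> H; suff: 0 <= sin x * -1 by lra.
by apply: H; lra.
Qed.

Lemma sin_lt0_2pi x : pi < x < 2 * pi -> sin x < 0.
Proof.
move=> h; have := @sin_gt0_pi R (x - pi); rewrite sinB cospi sinpi mulr0 subr0.
move=> H; suff: 0 < sin x * -1 by lra.
by apply: H; lra.
Qed.

Lemma cos_le0_3pihalf x : pi / 2 <= x <= 3 * (pi / 2) -> cos x <= 0.
Proof.
move=> h; have := @sin_ge0_pi R (x - pi / 2); rewrite sinB cos_pihalf sin_pihalf.
move=> H; suff: 0 <= sin x * 0 - cos x * 1 by lra.
by apply: H; lra.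
Qed.

Lemma sin_gt0_ltpi x : 0 <= x <= 2 * pi -> 0 < sin x -> 0 < x < pi.
Proof.
move=> h sx; apply/andP; split; rewrite ltNge; apply/negP => xp.
  have x0 : x = 0 by lra.
  by rewrite x0 sin0 in sx; lra.
by have := @sin_le0_2pi x; lra.
Qed.

Lemma cos_eq1_2pi x : 0 < x <= 2 * pi -> cos x = 1 -> x = 2 * pi.
Proof.
move=> h c1; have [xpi|xpi] := leP x pi.
  have : cos x < cos 0 by rewrite ltr_cos ?in_itv/= ?pi_ge0; lra.
  by rewrite cos0 c1 ltxx.
apply/eqP; rewrite -subr_eq0 -oppr_eq0 opprB; apply/eqP.
have e : cos (2 * pi - x) = cos 0.
  by rewrite cos0 addrC cos2pi_shift cosN.
by apply: cos_inj e; rewrite in_itv/= ?pi_ge0 ?lexx//; have := @pi_gt0 R; lra.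
Qed.

Definition ray (p : R * R) (r t : R) : R * R := (p.1 + r * cos t, p.2 + r * sin t).

Lemma polar (a : R) (p x : R * R) : x != p ->
  exists r t, [/\ 0 < r, a <= t <= a + 2 * pi & x = ray p r t].
Proof.
move=> xp.
(* [(X, Y)] is [x - p] in the frame turned by [a + pi]. In that frame the angle is [acos] up to
   sign, hence in [[- pi, pi]], which puts [t] in the required interval. *)
pose X := cos (a + pi) * (x.1 - p.1) + sin (a + pi) * (x.2 - p.2).
pose Y := cos (a + pi) * (x.2 - p.2) - sin (a + pi) * (x.1 - p.1).
have XY : X ^+ 2 + Y ^+ 2 = (x.1 - p.1) ^+ 2 + (x.2 - p.2) ^+ 2.
  have := cos2Dsin2 (a + pi); rewrite /X /Y; set c := cos _; set s := sin _ => cs.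
  transitivity ((c ^+ 2 + s ^+ 2) * ((x.1 - p.1) ^+ 2 + (x.2 - p.2) ^+ 2)); first by ring.
  by rewrite cs mul1r.
have N0 : 0 < X ^+ 2 + Y ^+ 2.
  rewrite XY lt_neqAle eq_sym addr_ge0 ?sqr_ge0// andbT paddr_eq0 ?sqr_ge0//.
  by rewrite !sqrf_eq0 !subr_eq0; apply: contra xp => /andP[/eqP h1 /eqP h2]; case: (x) (p) h1 h2 => ? ? [? ?] /= -> ->.
pose r := Num.sqrt (X ^+ 2 + Y ^+ 2).
have r0 : 0 < r by rewrite sqrtr_gt0.
have r2 : r ^+ 2 = X ^+ 2 + Y ^+ 2 by rewrite sqr_sqrtr// ltW.
have Xr : -1 <= X / r <= 1.
  have : `|X / r| <= 1.
    rewrite normrM normfV (gtr0_norm r0) ler_pdivrMr// mul1r -[leRHS](gtr0_norm r0).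
    by rewrite -ler_sqr ?nnegrE ?normr_ge0// !real_normK ?num_real// r2 lerDl sqr_ge0.
  by rewrite ler_norml.
have sq : Num.sqrt (1 - (X / r) ^+ 2) = `|Y| / r.
  have -> : 1 - (X / r) ^+ 2 = (Y / r) ^+ 2.
    rewrite !exprMn !exprVn r2; field; lra.
  by rewrite sqrtr_sqr normrM normfV (gtr0_norm r0).
have key t : cos t = X / r -> sin t = Y / r -> x = ray p r (a + pi + t).
  move=> ct st; rewrite /ray (cosD (a + pi)) (sinD (a + pi)) ct st.
  have := cos2Dsin2 (a + pi); rewrite /X /Y; set c := cos _; set s := sin _ => cs.
  have E1 : x.1 = p.1 + (c ^+ 2 + s ^+ 2) * (x.1 - p.1) by rewrite cs; ring.
  have E2 : x.2 = p.2 + (c ^+ 2 + s ^+ 2) * (x.2 - p.2) by rewrite cs; ring.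
  rewrite [LHS]surjective_pairing; congr pair; first by rewrite {1}E1; field; lra.
  by rewrite {1}E2; field; lra.
have [Y0|Y0] := leP 0 Y.
  exists r, (a + pi + acos (X / r)); split => //.
    by have := acos_ge0 Xr; have := acos_lepi Xr; have := @pi_gt0 R; lra.
  by apply: key; [rewrite acosK ?in_itv/=|rewrite sin_acos// sq ger0_norm].
exists r, (a + pi + - acos (X / r)); split => //.
  by have := acos_ge0 Xr; have := acos_lepi Xr; have := @pi_gt0 R; lra.
by apply: key; [rewrite cosN acosK ?in_itv/=|rewrite sinN sin_acos// sq ltr0_norm// mulNr opprK].
Qed.

(* Cross product of the unit vector of direction [t] with [x - p]: positive iff
   [x] lies to the left of the line through [p] in direction [t]. *)
Definition side (t : R) (p x : R * R) : R := cos t * (x.2 - p.2) - sin t * (x.1 - p.1).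

Lemma side_ray t p r u : side t p (ray p r u) = r * sin (u - t).
Proof. by rewrite /side /ray sinB /=; ring. Qed.

Lemma sideD t (p q x : R * R) : side t p x = side t p q + side t q x.
Proof. by rewrite /side; ring. Qed.

Lemma side_id t p : side t p p = 0.
Proof. by rewrite /side !subrr !mulr0 subrr. Qed.

Lemma side_anti t (p x : R * R) : side t x p = - side t p x.
Proof. by rewrite /side; ring. Qed.

Lemma ray_shift p r t : ray p r (t + 2 * pi) = ray p r t.
Proof. by rewrite /ray cos2pi_shift sin2pi_shift. Qed.

Lemma side0_ray t (p x : R * R) : x != p -> side t p x = 0 ->
  (exists2 r, 0 < r & x = ray p r t) \/ (exists2 r, 0 < r & x = ray p (- r) t).
Proof.
move=> xp s0; have [r [u [r0 hu xE]]] := @polar t p x xp.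
move: s0; rewrite xE side_ray => /eqP; rewrite mulf_eq0 gt_eqF//= => /eqP su.
have [upi|upi] := ltP 0 (sin (u - t)); first by lra.
have [u0|u0] := eqVneq u t; first by left; exists r; rewrite ?u0.
have [u2|u2] := eqVneq u (t + 2 * pi); first by left; exists r; rewrite // u2 ray_shift.
have u1 : u - t = pi.
  have [h|h|//] := ltgtP (u - t) pi.
    by have := @sin_gt0_pi R (u - t); lra.
  by have := @sin_lt0_2pi (u - t); lra.
right; exists r => //; have -> : u = t + pi by lra.
by rewrite /ray cosDpi sinDpi !mulrN !mulNr.
Qed.

End Trig.

(** * Cones and their emptiness *)

Section Cone.
Variables (R : realType) (Th : R).
Hypotheses (Th0 : 0 < Th) (Thpi : Th < pi).
Ltac tlra := move: (Th0) (Thpi) => ? ?; slra.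
Implicit Types (t : R) (p q k g h x : R * R).

(** As [Th < pi], the cone is the intersection of two open half-planes. *)
Lemma cone_side p t q : cone Th p t q <-> 0 < side t p q /\ side (t + Th) p q < 0.
Proof.
split.
  move=> [r [u [r0 hu ->]]]; rewrite -/(ray p r u) !side_ray; split.
    by apply: mulr_gt0 => //; apply: sin_gt0_pi; tlra.
  rewrite pmulr_rlt0// -oppr_gt0 -sinN; apply: sin_gt0_pi; tlra.
move=> [s1 s2]; have qp : q != p.
  by apply: contraTneq s1 => ->; rewrite side_id ltxx.
have [r [u [r0 hu qE]]] := @polar R t p q qp.
move: s1 s2; rewrite qE !side_ray pmulr_rgt0// pmulr_rlt0// => s1 s2.
have h1 := @sin_gt0_ltpi R (u - t).
exists r, u; split=> //; apply/andP; split; first tlra.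
rewrite ltNge; apply/negP => uh.
by have := @sin_ge0_pi R (u - (t + Th)); tlra.
Qed.

End Cone.

Definition empty_cone (R : realType) (Th : R) (G : {fset (R * R)}) (p : R * R) (t : R) :=
  forall k, k \in G -> ~ (0 < side t p k /\ side (t + Th) p k < 0).

(* An open condition on [p], so no boundary point of the region satisfies it. *)
Definition strictly_empty (R : realType) (Th : R) (G : {fset (R * R)}) (p : R * R) (t : R) :=
  forall k, k \in G -> side t p k < 0 \/ 0 < side (t + Th) p k.

(** Equality of angles modulo [2 * pi]. *)
Definition same_dir (R : realType) (t u : R) := cos t = cos u /\ sin t = sin u.

Lemma near_all_in (T : choiceType) (U : Type) (F : set_system U) (FF : Filter F)
    (P : T -> U -> Prop) (s : seq T) :
  (forall k, k \in s -> \forall x \near F, P k x) ->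
  \forall x \near F, forall k, k \in s -> P k x.
Proof.
elim: s => [|a s IH] H; first by apply: nearW.
have H1 := H a (mem_head _ _).
have H2 : \forall x \near F, forall k, k \in s -> P k x.
  by apply: IH => k ks; apply: H; rewrite inE ks orbT.
by apply: filterS2 H1 H2 => x Pa Ps k; rewrite inE => /orP[/eqP->|/Ps].
Qed.

Lemma near_fset (T : choiceType) (U : Type) (F : set_system U) (FF : Filter F)
    (P : T -> U -> Prop) (G : {fset T}) :
  (forall k, k \in G -> \forall x \near F, P k x) ->
  \forall x \near F, forall k, k \in G -> P k x.
Proof. exact: near_all_in. Qed.

(** * Directions modulo full turns *)

Section Dir.
Variable R : realType.
Implicit Types (t u : R) (p q k g h x : R * R).

Lemma dir_side t u p x : same_dir t u -> side t p x = side u p x.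
Proof. by rewrite /side => -[-> ->]. Qed.

Lemma dir_ray t u p r : same_dir t u -> ray p r t = ray p r u.
Proof. by rewrite /ray => -[-> ->]. Qed.

Lemma dirD t u a : same_dir t u -> same_dir (t + a) (u + a).
Proof. by rewrite /same_dir !cosD !sinD => -[-> ->]. Qed.

Lemma dir_sym t u : same_dir t u -> same_dir u t.
Proof. by case=> h1 h2; split; rewrite ?h1 ?h2. Qed.

Lemma dir_trans t u v : same_dir t u -> same_dir u v -> same_dir t v.
Proof. by case=> h1 h2 [h3 h4]; split; rewrite ?h1 ?h2. Qed.

Lemma dir_2pi t : same_dir (t + 2 * pi) t.
Proof. by split; rewrite ?cos2pi_shift ?sin2pi_shift. Qed.

Lemma ray_inj_dir p r r' t t' : 0 < r -> 0 < r' -> ray p r t = ray p r' t' ->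
  r = r' /\ same_dir t t'.
Proof.
move=> r0 r0' [/addrI e1 /addrI e2].
have : r ^+ 2 = r' ^+ 2.
  have -> : r ^+ 2 = (r * cos t) ^+ 2 + (r * sin t) ^+ 2.
    by rewrite !exprMn -mulrDr cos2Dsin2 mulr1.
  by rewrite e1 e2 !exprMn -mulrDr cos2Dsin2 mulr1.
move=> /eqP; rewrite eqrXn2// ?ltW// => /eqP rr; split=> //.
by rewrite rr in e1 e2; split; apply: (mulfI (lt0r_neq0 r0')).
Qed.

Lemma dir_norm a t : exists2 u, a <= u <= a + 2 * pi & same_dir u t.
Proof.
have : ray (0, 0) 1 t != (0, 0).
  apply/eqP => -[]; rewrite !add0r !mul1r => c s.
  by have := cos2Dsin2 t; rewrite c s; lra.
move=> /(polar a)[r [u [r0 hu /ray_inj_dir]]] [|//|_ d]; first by lra.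
by exists u => //; apply: dir_sym.
Qed.

Lemma side_cont k : continuous (fun z : (R * R) * R => side z.2 z.1 k).
Proof.
move=> [p t]; rewrite /side /=.
apply: cvgB; apply: cvgM.
- apply: continuous_comp; [exact: cvg_snd|exact: continuous_cos].
- apply: cvgB; first exact: cvg_cst.
  apply: (@continuous_comp _ _ _ (fun z : (R * R) * R => z.1) snd); [exact: cvg_fst|exact: cvg_snd].
- apply: continuous_comp; [exact: cvg_snd|exact: continuous_sin].
- apply: cvgB; first exact: cvg_cst.
  apply: (@continuous_comp _ _ _ (fun z : (R * R) * R => z.1) fst); [exact: cvg_fst|exact: cvg_fst].
Qed.

Lemma side_contD a k : continuous (fun z : (R * R) * R => side (z.2 + a) z.1 k).
Proof.
move=> z.
apply: (@continuous_comp _ _ _ (fun z : (R * R) * R => (z.1, z.2 + a)) (fun z : (R * R) * R => side z.2 z.1 k)); last exact: side_cont.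
apply: (@cvg_pair _ _ _ _ (nbhs z.1) (nbhs (z.2 + a))); first exact: cvg_fst.
by apply: cvgD; [exact: cvg_snd|exact: cvg_cst].
Qed.

Lemma near_gt0 (T : topologicalType) (f : T -> R) (x : T) :
  {for x, continuous f} -> 0 < f x -> \forall y \near x, 0 < f y.
Proof. by move=> cf fx; exact: (cf [set y | 0 < y] (lt_nbhsr fx)). Qed.

Lemma near_lt0 (T : topologicalType) (f : T -> R) (x : T) :
  {for x, continuous f} -> f x < 0 -> \forall y \near x, f y < 0.
Proof. by move=> cf fx; exact: (cf [set y | y < 0] (lt_nbhsl fx)). Qed.

(** Directions form a circle, so compactness of [[- pi, pi]] turns neighbourhoods of the pairs
    [(p, t)] into one neighbourhood of [p] that serves all directions. *)
Lemma near_dirs (P : R * R -> R -> Prop) p :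
  (forall t, \forall z \near (p, t), P z.1 z.2) ->
  (forall q t u, same_dir t u -> P q t -> P q u) ->
  \forall q \near p, forall t, P q t.
Proof.
move=> H PD.
have cK : compact `[(- pi : R), pi]%classic .
  exact: segment_compact.
have := (iffLR (compact_near_coveringP _) cK) _ (nbhs p) P _.
have HH : forall x : R, `[(- pi : R), pi]%classic x -> \forall x' \near x & i \near p, P i x'.
  move=> t _; have := H t.
  case=> -[/= U V] [U1 V1] UV.
  exists (V, U); first by split.
  by move=> [a b] [/= Va Ub]; apply: (UV (b, a)).
move=> /(_ _ HH); apply: filterS => q Pq t.
have [u hu du] := dir_norm (- pi) t.
by apply: PD du (Pq u _); rewrite /= in_itv/=; lra.
Qed.

End Dir.

(** * Empty cones and the boundary of the region *)

Section Region.
Variables (R : realType) (Th : R) (G : {fset (R * R)}).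
Hypotheses (Thge : pi / 2 <= Th) (Thpi : Th < pi).
Implicit Types (t u : R) (p q k g h x : R * R).
Let A := theta_region G Th.
Ltac tlra := move: (@pi_gt0 R) (Thge) (Thpi) => ? ? ?; slra.

Lemma Th_gt0 : 0 < Th. Proof. tlra. Qed.

Lemma regionNP p : ~ A p <-> exists t, empty_cone Th G p t.
Proof.
have cs := cone_side Th_gt0 Thpi.
split=> [/existsNP[t nt]|[t et] Ap].
  by exists t => k kG /cs ck; apply: nt; exists k.
by have [k kG /cs ck] := Ap t; apply: (et k).
Qed.

Lemma emp_dir p t u : same_dir t u -> empty_cone Th G p t -> empty_cone Th G p u.
Proof.
move=> d et k kG; rewrite -(dir_side p k d) -(dir_side p k (dirD Th d)).
exact: et.
Qed.

Lemma near_not_emp p t : ~ empty_cone Th G p t -> \forall z \near (p, t), ~ empty_cone Th G z.1 z.2.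
Proof.
move=> /existsNP[k /not_implyP[kG /contrapT[s1 s2]]].
have n1 := near_gt0 (@side_cont R k (p, t)) s1.
have n2 := near_lt0 (@side_contD R Th k (p, t)) s2.
by apply: filterS2 n1 n2 => z z1 z2 /(_ k kG); apply.
Qed.

(** A guard inside a cone stays inside under small changes of apex and direction, and [near_dirs]
    makes this uniform in the direction. *)
Lemma region_open : open A.
Proof.
rewrite openE => p Ap; rewrite /interior.
have : \forall q \near p, forall t, ~ empty_cone Th G q t.
  apply: near_dirs => [t|q t u d h /(emp_dir (dir_sym d))]; last exact: h.
  by apply: near_not_emp => et; apply: (iffRL (regionNP p)) Ap; exists t.
apply: filterS => q nq; apply: contrapT => /regionNP[t]; exact: nq.
Qed.

Lemma boundaryE p : boundary A p <-> closure A p /\ ~ A p.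
Proof. by rewrite /boundary (interior_id _).1//; exact: region_open. Qed.

Lemma boundary_closed : closed (boundary A).
Proof.
have -> : boundary A = closure A `&` ~` A.
  by apply/seteqP; split=> p /boundaryE.
by apply: closedI; [exact: closed_closure|exact: open_closedC region_open].
Qed.

Lemma boundary_emp p : boundary A p -> exists t, empty_cone Th G p t.
Proof. by move=> /boundaryE[_ /regionNP]. Qed.

Lemma strictly_empty_near p t : strictly_empty Th G p t ->
  \forall q \near p, strictly_empty Th G q t.
Proof.
move=> se; apply: (@near_fset _ _ (nbhs p) _ (fun k q => side t q k < 0 \/ 0 < side (t + Th) q k)) => k kG.
have cp a : {for p, continuous (fun q => side a q k)}.
  apply: (@continuous_comp _ _ _ (fun q : R * R => (q, a)) (fun z => side z.2 z.1 k)); last exact: side_cont.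
  by apply: (@cvg_pair _ _ _ _ (nbhs p) (nbhs a)); [exact: cvg_id|exact: cvg_cst].
case: (se k kG) => sk.
  by apply: filterS (near_lt0 (cp t) sk) => q; left.
by apply: filterS (near_gt0 (cp (t + Th)) sk) => q; right.
Qed.

Lemma strictly_empty_emp p t : strictly_empty Th G p t -> empty_cone Th G p t.
Proof. by move=> se k /se[] h1 [h2 h3]; lra. Qed.

Lemma boundary_not_strict p t : boundary A p -> ~ strictly_empty Th G p t.
Proof.
move=> /boundaryE[cA _] /strictly_empty_near se.
have [q [Aq sq]] := cA _ se.
by apply: (iffRL (regionNP q)) Aq; exists t; exact: strictly_empty_emp.
Qed.

(** The open cone at [p] contains the closed cone of the same direction at each of its points [x],
    so the latter would be strictly empty. *)
Lemma boundary_not_in_cone p t x : boundary A x -> empty_cone Th G p t ->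
  ~ (0 < side t p x /\ side (t + Th) p x < 0).
Proof.
move=> bx et [s1 s2]; apply: (@boundary_not_strict x t bx) => k kG.
have [h1|h1] := ltP 0 (side t p k); last first.
  by left; have := sideD t p x k; lra.
have [h2|h2] := ltP (side (t + Th) p k) 0; first by case: (et k kG).
by right; have := sideD (t + Th) p x k; lra.
Qed.

Lemma near_side_angle p k t (f : R -> R) : {for 0, continuous f} -> f 0 = t ->
  {for 0, continuous (fun e => side (f e) p k)}.
Proof.
move=> cf f0.
apply: (@continuous_comp _ _ _ (fun e : R => (p, f e)) (fun z => side z.2 z.1 k)); last exact: side_cont.
by apply: (@cvg_pair _ _ _ _ (nbhs p) (nbhs (f 0))); [exact: cvg_cst|exact: cf].
Qed.

(** The sign [s] is the sense of a small turn: clockwise for [1], counterclockwise for [-1]. A guard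
    on a bounding ray must be left behind by the turn, which prescribes [s]; all other guards stay
    outside by continuity. *)
Lemma rotate_strict (s : R) p t : p \notin G -> empty_cone Th G p t ->
  (forall k r, k \in G -> 0 < r -> k = ray p r t -> s = -1) ->
  (forall k r, k \in G -> 0 < r -> k = ray p r (t + Th) -> s = 1) ->
  exists e, strictly_empty Th G p (t - s * e).
Proof.
move=> pG et HR HL.
have : \forall e \near (0 : R)^'+, strictly_empty Th G p (t - s * e).
  apply: (@near_fset _ _ (0 : R)^'+ _ (fun k e => side (t - s * e) p k < 0 \/ 0 < side (t - s * e + Th) p k)) => k kG.
  have kp : k != p by apply: contraNneq pG => <-.
  have c0 a : {for 0, continuous (fun e => a - s * e : R)}.
    apply: cvgB; first exact: cvg_cst.
    by apply: cvgM; [exact: cvg_cst|exact: cvg_id].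
  have c1 : {for 0, continuous (fun e => side (t - s * e) p k)}.
    by apply: near_side_angle (c0 t) _; exact: erefl.
  have c2 : {for 0, continuous (fun e => side (t - s * e + Th) p k)}.
    have -> : (fun e => side (t - s * e + Th) p k) = (fun e => side ((t + Th) - s * e) p k).
      by apply/funext => e; rewrite addrAC.
    by apply: near_side_angle (c0 (t + Th)) _; exact: erefl.
  have smalle : \forall e \near (0 : R)^'+, 0 < e < pi.
    near=> e; apply/andP; split; near: e; first exact: nbhs_right_gt.
    by apply: nbhs_right_lt; exact: pi_gt0.
  have [h1|h1] := ltP (side t p k) 0.
    apply: cvg_within; have := near_lt0 c1; rewrite mulr0 subr0 => /(_ h1).
    by apply: filterS => e; left.
  have [h2|h2] := ltP 0 (side (t + Th) p k).
    apply: cvg_within; have := near_gt0 c2; rewrite mulr0 subr0 => /(_ h2).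
    by apply: filterS => e; right.
  have [h3|h3] := eqVneq (side t p k) 0.
    have [[r r0 kE]|[r r0 kE]] := side0_ray kp h3; last first.
      move: h2; rewrite kE side_ray mulNr oppr_le0 pmulr_rge0// => h.
      have := @sin_gt0_pi R Th; have -> : Th = - (t - (t + Th)) by ring.
      by rewrite sinN; tlra.
    have sE := HR _ _ kG r0 kE; apply: filterS smalle => e e0; left.
    rewrite kE side_ray sE pmulr_rlt0//.
    have -> : t - (t - -1 * e) = - e by ring.
    by rewrite sinN oppr_lt0; apply: sin_gt0_pi.
  have [h4|h4] := eqVneq (side (t + Th) p k) 0; last first.
    by exfalso; apply: (et k kG); split; rewrite lt_neqAle ?h2 ?h1 ?andbT// eq_sym.
  have [[r r0 kE]|[r r0 kE]] := side0_ray kp h4; last first.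
    move: h1; rewrite kE side_ray mulNr oppr_ge0 pmulr_rle0// => h.
    have := @sin_gt0_pi R Th; have -> : Th = (t + Th) - t by ring.
    by tlra.
  have sE := HL _ _ kG r0 kE; apply: filterS smalle => e e0; right.
  rewrite kE side_ray sE pmulr_rgt0//.
  have -> : t + Th - (t - 1 * e + Th) = e by ring.
  exact: sin_gt0_pi.
by move=> /filter_ex[e he]; exists e.
Unshelve. all: by end_near. Qed.

(** Otherwise a small clockwise turn would leave the guards of the left ray behind and make the cone
    strictly empty. *)
Lemma emp_right p t : boundary A p -> p \notin G -> empty_cone Th G p t ->
  exists k r, [/\ k \in G, 0 < r & k = ray p r t].
Proof.
move=> bp pG et; apply: contrapT => N.
have [||e] := @rotate_strict 1 p t pG et; last exact: boundary_not_strict.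
  by move=> k r kG r0 kE; case: N; exists k, r.
by [].
Qed.

Lemma emp_left p t : boundary A p -> p \notin G -> empty_cone Th G p t ->
  exists k r, [/\ k \in G, 0 < r & k = ray p r (t + Th)].
Proof.
move=> bp pG et; apply: contrapT => N.
have [||e] := @rotate_strict (-1) p t pG et; last exact: boundary_not_strict.
  by [].
by move=> k r kG r0 kE; case: N; exists k, r.
Qed.

End Region.

(** * Circular arcs traced by a rotating empty cone *)

Section Walk.
Variable R : realType.
Implicit Types (t u : R).

(** [v] is the infimum of the parameters from [t0] on at which the open condition [Q] fails. *)
Lemma walk (Q : R -> Prop) t0 t1 :
  (forall t, Q t -> \forall u \near t, Q u) -> Q t0 -> t0 < t1 -> ~ Q t1 ->
  exists2 v, t0 < v & (forall u, t0 <= u < v -> Q u) /\ ~ Q v.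
Proof.
move=> oQ Q0 t01 Q1.
pose S := [set u | t0 <= u /\ ~ Q u].
have lS : has_lbound S by exists t0 => u [].
have iS : has_inf S by split=> //; exists t1; split=> //; exact: ltW.
have t0S : t0 <= inf S by apply: lb_le_inf; [exact: iS.1|move=> u []].
have nS u : t0 <= u < inf S -> Q u.
  move=> hu; apply: contrapT => nQ.
  have : inf S <= u by apply: ge_inf => //; split=> //; slra.
  slra.
have nv : ~ Q (inf S).
  move=> Qv; have [e /= e0 he] := oQ _ Qv.
  have [u [tu nu] uS] := inf_adherent e0 iS.
  have : inf S <= u by apply: ge_inf.
  move=> Su; apply: nu; apply: he => /=.
  by rewrite distrC ger0_norm; slra.
exists (inf S) => //.
rewrite lt_neqAle t0S andbT; apply/eqP => e; by apply: nv; rewrite -e.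
Qed.

Lemma near_below t0 v (P : R -> Prop) : t0 < v -> (\forall u \near v, P u) ->
  exists2 u, t0 <= u < v & P u.
Proof.
move=> tv nP.
have nl : \forall u \near v^'-, [/\ t0 <= u, u < v & P u].
  near=> u; split; near: u.
  - exact: nbhs_left_ge.
  - exact: nbhs_left_lt.
  - exact: cvg_within.
by have [u [h1 h2 h3]] := filter_ex nl; exists u => //; rewrite h1.
Unshelve. all: by end_near. Qed.

(* Half-open quadrants: two directions in one of them form an angle < pi/2. *)
Definition quad (j : nat) t := 0 < cos (t - j%:R * (pi / 2)) /\ 0 <= sin (t - j%:R * (pi / 2)).

Lemma quad_exists t : exists2 j, j \in iota 0 4 & quad j t.
Proof.
have c1 : cos (t - pi / 2) = sin t by exact: cosBpihalf.
have s1 : sin (t - pi / 2) = - cos t by exact: sinBpihalf.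
have e2 : t - 2 * (pi / 2) = t - pi / 2 - pi / 2 by ring.
have e3 : t - 3 * (pi / 2) = t - pi / 2 - pi / 2 - pi / 2 by ring.
have h := cos2Dsin2 t.
have [c0|c0] := ltP 0 (cos t); have [s0|s0] := ltP 0 (sin t).
- by exists 0%N => //; split; rewrite mul0r subr0 // ltW.
- have [z|z] := eqVneq (sin t) 0.
    by exists 0%N => //; split; rewrite mul0r subr0 // z.
  exists 3%N => //; split; rewrite e3 ?cosBpihalf ?sinBpihalf ?cosBpihalf ?sinBpihalf.
    by rewrite oppr_gt0 lt_neqAle z s0.
  by rewrite opprK ltW.
- by exists 1%N => //; split; rewrite mul1r ?c1 ?s1 ?oppr_ge0.
- have [z|z] := eqVneq (cos t) 0.
    have : sin t != 0 by apply: contraTneq (@ltr01 R) => sz; rewrite -h z sz expr0n/= addr0 ltxx.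
    move=> sn; exists 3%N => //; split; rewrite e3 ?cosBpihalf ?sinBpihalf ?cosBpihalf ?sinBpihalf.
      by rewrite oppr_gt0 lt_neqAle sn s0.
    by rewrite opprK z.
  exists 2%N => //; split; rewrite e2 ?cosBpihalf ?sinBpihalf ?cosBpihalf ?sinBpihalf ?oppr_ge0//.
  by rewrite oppr_gt0 lt_neqAle z c0.
Qed.

Lemma quad_cos j t u : quad j t -> quad j u -> 0 < cos (u - t).
Proof.
move=> [c1 s1] [c2 s2].
have -> : u - t = (u - j%:R * (pi / 2)) - (t - j%:R * (pi / 2)) by ring.
rewrite cosB; apply: ltr_pwDl; first exact: mulr_gt0.
exact: mulr_ge0.
Qed.

Lemma dir_of_sin0 t u : sin (u - t) = 0 -> 0 < cos (u - t) -> same_dir t u.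
Proof.
move=> s0 c0; have c1 : cos (u - t) = 1.
  have := cos2Dsin2 (u - t); rewrite s0 expr0n/= addr0 => /eqP.
  by rewrite sqrf_eq1 => /orP[/eqP//|/eqP h]; lra.
have uE : u = t + (u - t) by ring.
by rewrite uE; split; rewrite (cosD, sinD) s0 c1; ring.
Qed.

End Walk.

Section Arc.
Variables (R : realType) (Th : R) (G : {fset (R * R)}).
Hypotheses (Thge : pi / 2 <= Th) (Thpi : Th < pi).
Implicit Types (t u : R) (p q k g h x : R * R).
Ltac tlra := move: (@pi_gt0 R) (Thge) (Thpi) => ? ? ?; slra.

Lemma sinTh_gt0 : 0 < sin Th. Proof. by apply: sin_gt0_pi; tlra. Qed.
Lemma cosTh_le0 : cos Th <= 0. Proof. by apply: cos_le0_3pihalf; tlra. Qed.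

(* The closed cone spanned by the directions [t] and [t + Th], with [h] on the
   first ray and [g] on the second, contains no other guard.  Its apex, the
   intersection of two lines, is [apex g h t]. *)
Definition tight g h t :=
  [/\ g \in G, h \in G, 0 < side t h g, side (t + Th) g h < 0 &
   forall k, k \in G -> k != g -> k != h -> side t h k < 0 \/ 0 < side (t + Th) g k].

Definition apex g h t := ray h (side (t + Th) g h / sin Th) t.

Lemma apex_r g h t x : side t (apex g h t) x = side t h x.
Proof.
have := sideD t h (apex g h t) x.
by rewrite /apex side_ray subrr sin0 mulr0 add0r.
Qed.

Lemma apex_l g h t x : side (t + Th) (apex g h t) x = side (t + Th) g x.
Proof.
have := sideD (t + Th) g (apex g h t) x.
have e : side (t + Th) g (apex g h t) = 0; last by rewrite e add0r.
rewrite (sideD _ g h) /apex side_ray.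
have -> : t - (t + Th) = - Th by ring.
by rewrite sinN mulrN divfK ?subrr// gt_eqF// sinTh_gt0.
Qed.

Lemma sides_inj t p q : side t p q = 0 -> side (t + Th) p q = 0 -> q = p.
Proof.
move=> s1 s2; apply: contrapT => /eqP qp.
have sT := sinTh_gt0.
have [[r r0 e]|[r r0 e]] := side0_ray qp s1; move: s2; rewrite e side_ray;
  have -> : t - (t + Th) = - Th by ring.
  by rewrite sinN => /eqP; rewrite mulf_eq0 oppr_eq0 !gt_eqF.
by rewrite sinN => /eqP; rewrite mulrNN mulf_eq0 !gt_eqF.
Qed.

Lemma apexP g h t p : side t h p = 0 -> side (t + Th) g p = 0 -> p = apex g h t.
Proof.
by move=> s1 s2; apply: (@sides_inj t); rewrite ?apex_r ?apex_l.
Qed.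

Lemma apex_ray_r g h t : side (t + Th) g h < 0 ->
  exists2 r, 0 < r & h = ray (apex g h t) r t.
Proof.
move=> s; exists (- (side (t + Th) g h / sin Th)).
  by rewrite oppr_gt0 nmulr_rlt0// invr_gt0 sinTh_gt0.
by rewrite /apex /ray [LHS]surjective_pairing /=; congr pair; ring.
Qed.

Lemma apex_ray_l g h t : 0 < side t h g ->
  exists2 r, 0 < r & g = ray (apex g h t) r (t + Th).
Proof.
move=> s; have sT := sinTh_gt0; have gp : g != apex g h t.
  by apply: contraTneq s => ->; rewrite -(apex_r g) side_id ltxx.
have s0 : side (t + Th) (apex g h t) g = 0 by rewrite apex_l side_id.
have [[r r0 e]|[r r0 e]] := side0_ray gp s0; first by exists r.
have := side_ray t (apex g h t) (- r) (t + Th); rewrite -e apex_r.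
have -> : t + Th - t = Th by ring.
by move=> sE; move: s; rewrite sE mulNr oppr_gt0 pmulr_rlt0// ltNge ltW.
Qed.

Lemma tight_emp g h t : tight g h t -> empty_cone Th G (apex g h t) t.
Proof.
move=> [gG hG s1 s2 H] k kG; rewrite apex_r apex_l => -[k1 k2].
have [kg|kg] := eqVneq k g; first by move: k2; rewrite kg side_id ltxx.
have [kh|kh] := eqVneq k h; first by move: k1; rewrite kh side_id ltxx.
by case: (H k kG kg kh) => ?; lra.
Qed.

Lemma tight_apex_notin g h t : tight g h t -> apex g h t \notin G.
Proof.
move=> [gG hG s1 s2 H]; apply/negP => aG.
have r0 : side t h (apex g h t) = 0 by rewrite -(apex_r g) side_id.
have l0 : side (t + Th) g (apex g h t) = 0 by rewrite -(apex_l _ h) side_id.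
have [kg|kg] := eqVneq (apex g h t) g; first by move: r0; rewrite kg; lra.
have [kh|kh] := eqVneq (apex g h t) h; first by move: l0; rewrite kh; lra.
by case: (H _ aG kg kh); rewrite ?r0 ?l0 ltxx.
Qed.

Lemma dir_apex g h t u : same_dir t u -> apex g h t = apex g h u.
Proof. by move=> d; rewrite /apex (dir_side _ _ (dirD Th d)) (dir_ray _ _ d). Qed.

Lemma dir_tight g h t u : same_dir t u -> tight g h t -> tight g h u.
Proof.
move=> d [gG hG s1 s2 H]; have d2 := dirD Th d.
split; rewrite // -?(dir_side _ _ d) -?(dir_side _ _ d2)//.
by move=> k kG kg kh; rewrite -(dir_side _ _ d) -(dir_side _ _ d2); exact: H.
Qed.

Lemma side_acont a p k t : {for t, continuous (fun u => side (u + a) p k)}.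
Proof.
apply: (@continuous_comp _ _ _ (fun u : R => (p, u)) (fun z => side (z.2 + a) z.1 k)); last exact: side_contD.
by apply: (@cvg_pair _ _ _ _ (nbhs p) (nbhs t)); [exact: cvg_cst|exact: cvg_id].
Qed.

Lemma side_acont0 p k t : {for t, continuous (fun u => side u p k)}.
Proof.
have := @side_acont 0 p k t.
have -> : (fun u => side (u + 0) p k) = (fun u => side u p k) by apply/funext => u; rewrite addr0.
by [].
Qed.

Lemma tight_near g h t : tight g h t -> \forall u \near t, tight g h u.
Proof.
move=> [gG hG s1 s2 H].
have n1 := near_gt0 (@side_acont0 h g t) s1.
have n2 := near_lt0 (@side_acont Th g h t) s2.
have n3 : \forall u \near t, forall k, k \in G -> (k != g -> k != h -> side u h k < 0 \/ 0 < side (u + Th) g k).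
  apply: (@near_fset _ _ (nbhs t) _ (fun k u => k != g -> k != h -> side u h k < 0 \/ 0 < side (u + Th) g k)) => k kG.
  have [kg|kg] := eqVneq k g; first by apply: nearW.
  have [kh|kh] := eqVneq k h; first by apply: nearW.
  case: (H k kG kg kh) => s.
    by apply: filterS (near_lt0 (@side_acont0 h k t) s) => u; left.
  by apply: filterS (near_gt0 (@side_acont Th g k t) s) => u; right.
by apply: filterS3 n1 n2 n3 => u h1 h2 h3; split.
Qed.

Lemma apex_cont g h t : {for t, continuous (apex g h)}.
Proof.
rewrite /apex /ray.
have c : {for t, continuous (fun u => side (u + Th) g h / sin Th)}.
  by apply: cvgM; [exact: side_acont|exact: cvg_cst].
apply: (@cvg_pair _ _ _ _ (nbhs (h.1 + side (t + Th) g h / sin Th * cos t)) (nbhs (h.2 + side (t + Th) g h / sin Th * sin t))).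
  by apply: cvgD; [exact: cvg_cst|apply: cvgM; [exact: c|exact: continuous_cos]].
by apply: cvgD; [exact: cvg_cst|apply: cvgM; [exact: c|exact: continuous_sin]].
Qed.

(** A guard behind the apex on the line of one ray is strictly outside the half-plane of the other,
    so only guards on the rays themselves could violate the strict condition of [tight]. *)
Lemma tight_unique p t g h : p \notin G -> empty_cone Th G p t ->
  g \in G -> h \in G ->
  (exists2 r, 0 < r & h = ray p r t) -> (exists2 r, 0 < r & g = ray p r (t + Th)) ->
  (forall k r, k \in G -> 0 < r -> k = ray p r t -> k = h) ->
  (forall k r, k \in G -> 0 < r -> k = ray p r (t + Th) -> k = g) ->
  tight g h t /\ apex g h t = p.
Proof.
move=> pG et gG hG [r r0 hE] [m m0 gE] uh ug.
have sT := sinTh_gt0.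
have eT : t - (t + Th) = - Th by ring.
have eT' : t + Th - t = Th by ring.
have sh0 : side t p h = 0 by rewrite hE side_ray subrr sin0 mulr0.
have sg0 : side (t + Th) p g = 0 by rewrite gE side_ray subrr sin0 mulr0.
have sh x : side t h x = side t p x by rewrite (sideD t p h x) sh0 add0r.
have sg x : side (t + Th) g x = side (t + Th) p x by rewrite (sideD (t + Th) p g x) sg0 add0r.
split; last first.
  by symmetry; apply: apexP; rewrite ?sh ?sg side_id.
split=> //.
- by rewrite sh gE side_ray eT' mulr_gt0.
- by rewrite sg hE side_ray eT sinN mulrN oppr_lt0 mulr_gt0.
move=> k kG kg kh; rewrite sh sg.
have kp : k != p by apply: contraNneq pG => <-.
have [h1|h1] := ltP (side t p k) 0; first by left.
have [h2|h2] := ltP 0 (side (t + Th) p k); first by right.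
have [h3|h3] := eqVneq (side t p k) 0.
  have [[a a0 kE]|[a a0 kE]] := side0_ray kp h3.
    by move: kh; rewrite (uh k a)// eqxx.
  by move: h2; rewrite kE side_ray eT sinN mulrNN leNgt mulr_gt0.
have [h4|h4] := eqVneq (side (t + Th) p k) 0.
  have [[a a0 kE]|[a a0 kE]] := side0_ray kp h4.
    by move: kg; rewrite (ug k a)// eqxx.
  by move: h1; rewrite kE side_ray eT' mulNr oppr_ge0 leNgt mulr_gt0.
by exfalso; apply: (et k kG); split; rewrite lt_neqAle ?h2 ?h1 ?andbT// eq_sym.
Qed.

(** Of two right rays forming an angle less than [pi / 2], the one further counterclockwise would
    run inside the other cone because [Th >= pi / 2], and its guard would contradict emptiness. The
    apex [p] may itself be a guard. *)
Lemma gap_start_uniq p t u h k r s : empty_cone Th G p t -> empty_cone Th G p u ->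
  h \in G -> k \in G -> 0 < r -> 0 < s -> h = ray p r t -> k = ray p s u ->
  0 < cos (u - t) -> same_dir t u.
Proof.
move=> et eu hG kG r0 s0 hE kE c0.
have sT := sinTh_gt0; have cT := cosTh_le0.
have [sn|sn|sn] := ltgtP (sin (u - t)) 0; last exact: dir_of_sin0.
  exfalso; apply: (eu h hG); rewrite hE !side_ray.
  have e1 : sin (t - u) = - sin (u - t) by rewrite -sinN opprB.
  have e2 : cos (t - u) = cos (u - t) by rewrite -cosN opprB.
  split; first by rewrite e1 mulr_gt0// oppr_gt0.
  have -> : t - (u + Th) = (t - u) - Th by ring.
  rewrite sinB e1 e2 pmulr_rlt0// subr_lt0.
  apply: le_lt_trans (_ : 0 < _); last exact: mulr_gt0.
  by apply: mulr_ge0_le0 => //; rewrite oppr_ge0 ltW.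
exfalso; apply: (et k kG); rewrite kE !side_ray; split; first exact: mulr_gt0.
have -> : u - (t + Th) = (u - t) - Th by ring.
rewrite sinB pmulr_rlt0// subr_lt0.
apply: le_lt_trans (_ : 0 < _); last exact: mulr_gt0.
by apply: mulr_ge0_le0 => //; exact: ltW.
Qed.

Lemma gap_end_uniq p t u h k r s : empty_cone Th G p t -> empty_cone Th G p u ->
  h \in G -> k \in G -> 0 < r -> 0 < s -> h = ray p r (t + Th) -> k = ray p s (u + Th) ->
  0 < cos (u - t) -> same_dir t u.
Proof.
move=> et eu hG kG r0 s0 hE kE c0.
have sT := sinTh_gt0; have cT := cosTh_le0.
have [sn|sn|sn] := ltgtP (sin (u - t)) 0; last exact: dir_of_sin0.
  exfalso; apply: (et k kG); rewrite kE !side_ray; split.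
    have -> : u + Th - t = (u - t) + Th by ring.
    rewrite sinD mulr_gt0// ltr_wpDl//; last exact: mulr_gt0.
    by apply: mulr_le0 => //; exact: ltW.
  have -> : u + Th - (t + Th) = u - t by ring.
  by rewrite pmulr_rlt0.
exfalso; apply: (eu h hG); rewrite hE !side_ray.
have e1 : sin (t - u) = - sin (u - t) by rewrite -sinN opprB.
have e2 : cos (t - u) = cos (u - t) by rewrite -cosN opprB.
split.
  have -> : t + Th - u = (t - u) + Th by ring.
  rewrite sinD e1 e2 mulr_gt0// ltr_wpDl//; last exact: mulr_gt0.
  by apply: mulr_le0 => //; rewrite oppr_le0 ltW.
have -> : t + Th - (u + Th) = t - u by ring.
by rewrite e1 pmulr_rlt0// oppr_lt0.
Qed.

Definition arc_end g h t0 v :=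
  [/\ t0 < v, forall u, t0 <= u < v -> tight g h u & ~ tight g h v].

(** Half a turn reverses the sign of [side t h g], so tightness has failed by then. *)
Lemma arc_end_exists g h t : tight g h t -> exists v, arc_end g h t v.
Proof.
move=> tt; have := @walk R (tight g h) t (t + pi) (@tight_near g h) tt.
case; first by tlra.
  move=> [_ _ + _ _]; case: tt => _ _ + _ _.
  by rewrite /side cosDpi sinDpi; lra.
by move=> v tv [h1 h2]; exists v.
Qed.

(* The event that ends an arc at direction [v]: 0 - the guard [k] reaches the ray
   to [h] in front of [h]; 1 - a guard appears behind [g = k] on its ray;
   2 - [g] reaches the second ray of the cone at [h = k].  In each case [k] is
   the apex of an empty cone with a guard on a bounding ray, and the quadrant
   [j] of that ray determines [v]. *)
Definition key_rel (kap : nat * (R * R) * nat) g h v : Prop :=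
  match kap with (i, k, j) =>
  [/\ k \in G, empty_cone Th G k v &
  match i with
  | 0 => [/\ quad j v, (exists2 r, 0 < r & h = ray k r v) & side (v + Th) g k <= 0]
  | 1 => [/\ quad j (v + Th), (exists q r, [/\ q \in G, 0 < r & q = ray k r (v + Th)]) & k = g]
  | _ => [/\ quad j (v + Th), (exists q r, [/\ q \in G, 0 < r & q = ray k r (v + Th)]) & k = h]
  end]
  end.

Definition keys : seq (nat * (R * R) * nat) :=
  allpairs pair (allpairs pair (iota 0 3) (enum_fset G)) (iota 0 4).

Lemma size_keys : size keys = (12 * #|` G|)%N.
Proof. by rewrite /keys !size_allpairs !size_iota mulnC mulnA. Qed.

Lemma arc_end_key g h t0 v : arc_end g h t0 v ->
  exists2 kap, kap \in keys & key_rel kap g h v.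
Proof.
move=> [t0v ht nt].
have sT := sinTh_gt0.
have below P := @near_below R t0 v P t0v.
suff [i [k [i3 kG H]]] : exists i k, [/\ i \in iota 0 3, k \in G &
    forall j, quad j (if i == 0%N then v else v + Th) -> key_rel (i, k, j) g h v].
  have [j j4 qj] := quad_exists (if i == 0%N then v else v + Th).
  exists (i, k, j); last exact: H.
  by apply/allpairsP; exists ((i, k), j); split=> //; apply/allpairsP; exists (i, k).
have [gG hG s1 s2 H0] : tight g h t0 by apply: ht; slra.
(* The conditions that hold just below [v] pass to [v] as weak inequalities. *)
have w1 : 0 <= side v h g.
  rewrite leNgt; apply/negP => /(near_lt0 (@side_acont0 h g v))/below[u /ht[_ _ ? _ _]]; lra.
have w2 : side (v + Th) g h <= 0.
  rewrite leNgt; apply/negP => /(near_gt0 (@side_acont Th g h v))/below[u /ht[_ _ _ ? _]]; lra.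
have w3 k : k \in G -> ~ (0 < side v h k /\ side (v + Th) g k < 0).
  move=> kG [/(near_gt0 (@side_acont0 h k v)) n1 /(near_lt0 (@side_acont Th g k v)) n2].
  have [u /ht/tight_emp/(_ k kG)] := below _ (filterI n1 n2).
  by rewrite apex_r apex_l.
have gh : g != h by apply: contraTneq s1 => ->; rewrite side_id ltxx.
have near0 : \forall u \near v, v - pi < u.
  by apply: lt_nbhsr; tlra.
have sinpos u : v - pi < u -> u < v -> 0 < sin (v - u).
  by move=> *; apply: sin_gt0_pi; slra.
have eT : v - (v + Th) = - Th by ring.
(* If [g] were on the line of direction [v] through [h], then beyond [h] it would contradict [w2],
   and before [h] the tightness just below [v]. *)
have s1' : 0 < side v h g.
  rewrite lt_neqAle w1 andbT; apply/eqP => e.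
  have [[r r0 gE]|[r r0 gE]] := side0_ray gh (esym e).
    move: w2; rewrite side_anti gE side_ray eT sinN mulrN opprK leNgt.
    by rewrite mulr_gt0.
  have [u hu hu2] := below _ near0.
  have [_ _ + _ _] := ht _ hu; rewrite gE side_ray mulNr oppr_gt0 ltNge => /negP; apply.
  by apply/ltW/mulr_gt0 => //; apply: sinpos; slra.
(* If [g] and [h] line up on the left ray, the apex has moved to [h]: event 2. *)
have [e2|s2'] := eqVneq (side (v + Th) g h) 0.
  have e2' : side (v + Th) h g = 0 by rewrite side_anti e2 oppr0.
  have [[r r0 gE]|[r r0 gE]] := side0_ray gh e2'; last first.
    move: s1'; rewrite gE side_ray.
    have -> : v + Th - v = Th by ring.
    by rewrite mulNr oppr_gt0 ltNge mulr_ge0// ltW.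
  exists 2%N, h; split=> // j qj; split=> //.
    move=> k kG [k1 k2]; apply: (w3 k kG); split=> //.
    by have := sideD (v + Th) g h k; lra.
  by split=> //; exists g, r.
have s2'' : side (v + Th) g h < 0 by rewrite lt_neqAle s2' w2.
(* The pair is still in position, so another guard [k] obstructs the cone. *)
have [k /not_implyP[kG /not_implyP[kg /not_implyP[kh /not_orP[/negP k1 /negP k2]]]]] :
    exists k, ~ (k \in G -> k != g -> k != h -> side v h k < 0 \/ 0 < side (v + Th) g k).
  by apply: contrapT => /forallNP N; apply: nt; split=> // k; have /contrapT := N k.
rewrite -leNgt in k1; rewrite -leNgt in k2.
(* Beyond [h] on the right ray, [k] would have been inside the cone just below [v]; so it lies
   before [h]: event 0. *)
have [e1|n1] := eqVneq (side v h k) 0.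
  have [[r r0 kE]|[r r0 kE]] := side0_ray kh e1.
    have k2' : side (v + Th) g k < 0.
      rewrite (sideD _ g h) kE side_ray eT sinN mulrN.
      by have := mulr_gt0 r0 sT; lra.
    have [u hu [hu1 hu2]] := below _ (filterI near0 (near_lt0 (@side_acont Th g k v) k2')).
    have [] := tight_emp (ht _ hu) kG.
    rewrite apex_r apex_l; split=> //.
    by rewrite kE side_ray mulr_gt0//; apply: sinpos; slra.
  exists 0%N, k; split=> // j qj; split=> //.
    move=> x xG [x1 x2]; apply: (w3 x xG).
    by have := sideD v h k x; have := sideD (v + Th) g k x; lra.
  split=> //; exists r => //.
  by rewrite kE /ray [LHS]surjective_pairing /=; congr pair; ring.
have k1' : 0 < side v h k by rewrite lt_neqAle eq_sym n1.
(* On the left ray it is the other way round: [k] beyond [g] is event 1, and before [g] it would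
   have been inside the cone just below [v]. *)
have [e3|n3] := eqVneq (side (v + Th) g k) 0; last first.
  by exfalso; apply: (w3 k kG); rewrite k1' lt_neqAle n3.
have [[r r0 kE]|[r r0 kE]] := side0_ray kg e3.
  exists 1%N, g; split=> // j qj; split=> //.
    move=> x xG [x1 x2]; apply: (w3 x xG); split=> //.
    by have := sideD v h g x; lra.
  by split=> //; exists k, r.
have [u hu [hu1 hu2]] := below _ (filterI near0 (near_gt0 (@side_acont0 h k v) k1')).
have [] := tight_emp (ht _ hu) kG.
rewrite apex_r apex_l; split=> //.
rewrite kE side_ray; have -> : v + Th - (u + Th) = v - u by ring.
by rewrite mulNr oppr_lt0 mulr_gt0//; apply: sinpos; slra.
Qed.

End Arc.

(** * Charging arcs to the events that end them *)

Section Keys.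
Variables (R : realType) (Th : R) (G : {fset (R * R)}).
Hypotheses (Thge : pi / 2 <= Th) (Thpi : Th < pi).
Implicit Types (t u : R) (p q k g h x : R * R).
Ltac tlra := move: (@pi_gt0 R) (Thge) (Thpi) => ? ? ?; slra.

(** By tightness each of two different guards [g] and [g'] would be strictly to the left of the left
    line through the other. *)
Lemma tight_uniq_l g g' h u : tight Th G g h u -> tight Th G g' h u -> g = g'.
Proof.
move=> [gG hG s1 s2 H] [gG' _ s1' s2' H']; apply/eqP; apply: contrapT => /negP gg.
have gh : g != h by apply: contraTneq s1 => ->; rewrite side_id ltxx.
have gh' : g' != h by apply: contraTneq s1' => ->; rewrite side_id ltxx.
have := H g' gG'; rewrite eq_sym gg gh' => /(_ erefl erefl).
have := H' g gG; rewrite gg gh => /(_ erefl erefl).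
by have := side_anti (u + Th) g g'; case=> ? -[] ?; lra.
Qed.

Lemma tight_uniq_r g h h' u : tight Th G g h u -> tight Th G g h' u -> h = h'.
Proof.
move=> [gG hG s1 s2 H] [_ hG' s1' s2' H']; apply/eqP; apply: contrapT => /negP hh.
have gh : h != g by apply: contraTneq s1 => ->; rewrite side_id ltxx.
have gh' : h' != g by apply: contraTneq s1' => ->; rewrite side_id ltxx.
have hh' : h' != h by rewrite eq_sym.
have := side_anti u h h'.
by case: (H h' hG' gh' hh') => ?; case: (H' h hG gh hh) => ?; lra.
Qed.

Lemma arc_end_shift g h t0 v v' : arc_end Th G g h t0 v -> same_dir v v' ->
  arc_end Th G g h (t0 + (v' - v)) v'.
Proof.
move=> [t0v ht nt] d; split.
- by lra.
- move=> u hu; have du : same_dir (u + (v - v')) u.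
    have := dirD (u - v') d.
    have -> : v + (u - v') = u + (v - v') by ring.
    by have -> : v' + (u - v') = u by ring.
  by apply: (dir_tight du); apply: ht; slra.
by move=> h'; apply: nt; apply: dir_tight (dir_sym d) h'.
Qed.

Lemma key_dir kap g h v g' h' v' : g \in G -> h \in G -> g' \in G -> h' \in G ->
  key_rel Th G kap g h v -> key_rel Th G kap g' h' v' -> same_dir v v'.
Proof.
move: kap => [[[|i] k] j] gG hG gG' hG' [kG e1 H1] [_ e2 H2].
  move: H1 H2 => [q1 [r r0 hE] _] [q2 [r' r0' hE'] _].
  by apply: (gap_start_uniq Thge Thpi e1 e2 hG hG' r0 r0' hE hE'); apply: (quad_cos q1).
have [q1 [q [r [qG r0 qE]]]] : quad j (v + Th) /\ (exists q r, [/\ q \in G, 0 < r & q = ray k r (v + Th)]).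
  by case: (i) H1 => [|?] [].
have [q2 [q' [r' [qG' r0' qE']]]] : quad j (v' + Th) /\ (exists q r, [/\ q \in G, 0 < r & q = ray k r (v' + Th)]).
  by case: (i) H2 => [|?] [].
apply: (gap_end_uniq Thge Thpi e1 e2 qG qG' r0 r0' qE qE').
by have := quad_cos q1 q2; have -> : v' + Th - (v + Th) = v' - v by ring.
Qed.

Lemma arc_end_start g h t0 v : arc_end Th G g h t0 v -> tight Th G g h t0.
Proof. by move=> [t0v + _]; apply; slra. Qed.

(** Both cones are tight just below [v]. For events 1 and 2 the key contains [g] or [h], which fixes
    the other guard. For event 0, [h] and [h'] lie on one ray behind [k], and just below [v] each
    would be strictly to the right of the right line through the other. *)
Lemma key_inj_same kap g h t0 g' h' t0' v :
  arc_end Th G g h t0 v -> arc_end Th G g' h' t0' v ->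
  key_rel Th G kap g h v -> key_rel Th G kap g' h' v -> g = g' /\ h = h'.
Proof.
move=> A A' K K'.
have sT := sinTh_gt0 Thge Thpi.
pose m := Num.max t0 t0'.
have mv : m < v by case: A => ? _ _; case: A' => ? _ _; rewrite gt_max; slra.
have tm u : m <= u < v -> tight Th G g h u /\ tight Th G g' h' u.
  rewrite ge_max => hu; case: A => _ + _; case: A' => _ + _ => h1 h2.
  by split; [apply: h2|apply: h1]; slra.
move: kap K K' => [[[|[|i]] k] j] [kG _ H1] [_ _ H2].
- move: H1 H2 => [_ [r r0 hE] s1] [_ [r' r0' hE'] s2].
  have aux g0 h0 s : side (v + Th) g0 k <= 0 -> 0 < s -> h0 = ray k s v -> side (v + Th) g0 h0 < 0.
    move=> z1 s0 ->; rewrite (sideD _ _ k) side_ray.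
    have -> : v - (v + Th) = - Th by ring.
    by rewrite sinN mulrN; have := mulr_gt0 s0 sT; lra.
  have n1 := near_lt0 (@side_acont R Th g h' v) (aux _ _ _ s1 r0' hE').
  have n2 := near_lt0 (@side_acont R Th g' h v) (aux _ _ _ s2 r0 hE).
  have [u /tm[T T'] [h1 h2]] := near_below mv (filterI n1 n2).
  have hh : h = h'.
    apply/eqP; apply: contrapT => /negP hh.
    case: (T) => gG hG z1 z2 H; case: (T') => gG' hG' z1' z2' H'.
    have gh : h' != g by apply: contraTneq h1 => ->; rewrite side_id ltxx.
    have gh' : h != g' by apply: contraTneq h2 => ->; rewrite side_id ltxx.
    have hh' : h' != h by rewrite eq_sym.
    have := side_anti u h h'.
    by case: (H h' hG' gh hh') => ?; case: (H' h hG gh' hh) => ?; lra.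
  by split=> //; apply: tight_uniq_l T _; rewrite hh.
- have gg : g = g' by case: H1 => _ _ <-; case: H2.
  have [T T'] : tight Th G g h m /\ tight Th G g' h' m by apply: tm; rewrite lexx.
  by split=> //; apply: tight_uniq_r T _; rewrite gg.
- have hh : h = h' by case: H1 => _ _ <-; case: H2.
  have [T T'] : tight Th G g h m /\ tight Th G g' h' m by apply: tm; rewrite lexx.
  by split=> //; apply: tight_uniq_l T _; rewrite hh.
Qed.

(** The key serves as a name for the arc through the position [(p, t)] of the cone. *)
Definition arc_key kap p t := exists g h v,
  [/\ arc_end Th G g h t v, apex Th g h t = p & key_rel Th G kap g h v].

Lemma arc_key_exists g h t : tight Th G g h t ->
  exists2 kap, kap \in keys G & arc_key kap (apex Th g h t) t.
Proof.
move=> /(arc_end_exists Thge Thpi)[v A]; have [kap kk K] := arc_end_key Thge Thpi A.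
by exists kap => //; exists g, h, v.
Qed.

Lemma key_rel_dir kap g h v w : same_dir v w -> key_rel Th G kap g h v -> key_rel Th G kap g h w.
Proof.
move=> d; have dT := dirD Th d.
move: kap => [[[|[|i]] k] j] [kG e2 H2]; split=> //; try exact: (emp_dir d).
- case: H2 => -[q1 q2] [r r0 hE] s; split.
  + have dd := dirD (- (j%:R * (pi / 2))) d.
    by move: q1 q2; rewrite /quad dd.1 dd.2.
  + by exists r => //; rewrite -(dir_ray _ _ d).
  + by rewrite -(dir_side _ _ dT).
- case: H2 => -[q1 q2] [q [r [qG r0 hE]]] s; split=> //.
  + have dd := dirD (- (j%:R * (pi / 2))) dT.
    by move: q1 q2; rewrite /quad dd.1 dd.2.
  + by exists q, r; rewrite -(dir_ray _ _ dT).
- case: H2 => -[q1 q2] [q [r [qG r0 hE]]] s; split=> //.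
  + have dd := dirD (- (j%:R * (pi / 2))) dT.
    by move: q1 q2; rewrite /quad dd.1 dd.2.
  + by exists q, r; rewrite -(dir_ray _ _ dT).
Qed.

Lemma key_inj kap g h t0 v g' h' t0' v' :
  arc_end Th G g h t0 v -> arc_end Th G g' h' t0' v' ->
  key_rel Th G kap g h v -> key_rel Th G kap g' h' v' ->
  [/\ g = g', h = h', same_dir v v' & arc_end Th G g h (t0' + (v - v')) v].
Proof.
move=> A A' K K'.
have [gG hG _ _ _] := arc_end_start A; have [gG' hG' _ _ _] := arc_end_start A'.
have d : same_dir v v' := key_dir gG hG gG' hG' K K'.
have A2 := arc_end_shift A' (dir_sym d).
have K2 := key_rel_dir (dir_sym d) K'.
have [gg hh] := key_inj_same A A2 K K2.
by split; rewrite // gg hh.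
Qed.

Lemma arc_key_dir kap p t u : same_dir t u -> arc_key kap p t -> arc_key kap p u.
Proof.
move=> d [g [h [v [A aE K]]]].
have dv : same_dir v (v + (u - t)).
  have := dirD (v - t) d.
  have -> : t + (v - t) = v by ring.
  by have -> : u + (v - t) = v + (u - t) by ring.
exists g, h, (v + (u - t)); split.
- have := arc_end_shift A dv.
  by have -> : t + (v + (u - t) - v) = u by ring.
- by rewrite -(dir_apex _ _ _ d).
- exact: key_rel_dir dv K.
Qed.

(** Two positions with one key lie on a single arc, as do all positions between them. The angle
    [t''] is [t'] moved by full turns into the parametrization of the first arc; either position may
    come first. *)
Lemma arc_key_common kap p t p' t' : arc_key kap p t -> arc_key kap p' t' ->
  exists g h t'', [/\ same_dir t' t'', apex Th g h t = p, apex Th g h t'' = p' &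
    forall u, Num.min t t'' <= u <= Num.max t t'' ->
      tight Th G g h u /\ arc_key kap (apex Th g h u) u].
Proof.
move=> [g [h [v [A aE K]]]] [g' [h' [v' [A' aE' K']]]].
have [gg hh d A2] := key_inj A A' K K'.
exists g, h, (t' + (v - v')).
have d2 : same_dir t' (t' + (v - v')).
  have := dirD (t' - v') d.
  have -> : v + (t' - v') = t' + (v - v') by ring.
  have -> : v' + (t' - v') = t' by ring.
  exact: dir_sym.
split=> //.
  by rewrite -(dir_apex _ _ _ d2) gg hh.
move=> u /andP[m1 m2].
have uv : u < v.
  by apply: le_lt_trans m2 _; rewrite gt_max; case: A => -> _ _; case: A2 => ->.
have [T0 T1] : (forall w, u <= w < v -> tight Th G g h w) /\ tight Th G g h u.
  suff h0 w : u <= w < v -> tight Th G g h w by split=> //; apply: h0; rewrite lexx.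
  move=> /andP[w1 w2]; have := le_trans m1 w1; rewrite ge_min => /orP[z|z].
    by case: A => _ + _; apply; slra.
  by case: A2 => _ + _; apply; slra.
split=> //; exists g, h, v; split=> //; split=> //.
by case: A.
Qed.

End Keys.

(** * Points with two empty cones *)

Section Cross.
Variables (R : realType) (Th : R) (G : {fset (R * R)}).
Hypotheses (Thge : pi / 2 <= Th) (Thpi : Th < pi).
Implicit Types (t u : R) (p q k g h x y e : R * R).
Ltac tlra := move: (@pi_gt0 R) (Thge) (Thpi) => ? ? ?; slra.

Definition dot e x y := (x.1 - e.1) * (y.1 - e.1) + (x.2 - e.2) * (y.2 - e.2).
Definition cross e x y := (x.1 - e.1) * (y.2 - e.2) - (x.2 - e.2) * (y.1 - e.1).
(* Proportional to the power of [q] with respect to the circle of the points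
   from which the counterclockwise angle from [h] to [g] is [Th]; it is
   non-negative inside this circle. *)
Definition circ g h q := cos Th * cross q h g - sin Th * dot q h g.

Lemma dot_ray e r t r' t' : dot e (ray e r t) (ray e r' t') = r * r' * cos (t' - t).
Proof. by rewrite /dot /ray cosB /=; ring. Qed.

Lemma crs_ray e r t r' t' : cross e (ray e r t) (ray e r' t') = r * r' * sin (t' - t).
Proof. by rewrite /cross /ray sinB /=; ring. Qed.

Lemma circ_ray e r t r' t' : circ (ray e r' t') (ray e r t) e = r * r' * sin (t' - t - Th).
Proof. by rewrite /circ dot_ray crs_ray (sinB (t' - t) Th); ring. Qed.

Lemma dot_gt0 e x : x != e -> 0 < dot e x x.
Proof.
move=> xe; have [r [t [r0 _ ->]]] := polar 0 xe.
by rewrite dot_ray subrr cos0 mulr1 mulr_gt0.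
Qed.

(* If the cones of directions [t1] and [t2] at [e] are empty, all guards lie in
   [wedge e t1 t2] (from the end of the first cone to the start of the second)
   or in [wedge e t2 (t1 + 2 * pi)].  Exchanging [(t1, t2)] with
   [(t2, t1 + 2 * pi)] exchanges the two wedges. *)
Definition wedge e a b x := exists r t, [/\ 0 < r, a + Th <= t <= b & x = ray e r t].

Variables t1 t2 : R.
Hypotheses (h1 : t1 + Th <= t2) (h2 : t2 + Th <= t1 + 2 * pi).
Ltac wlra := move: (@pi_gt0 R) (Thge) (Thpi) (h1) (h2) => ? ? ? ? ?; slra.

Lemma wedge_cover e x : x != e ->
  ~ (0 < side t1 e x /\ side (t1 + Th) e x < 0) ->
  ~ (0 < side t2 e x /\ side (t2 + Th) e x < 0) ->
  wedge e t1 t2 x \/ wedge e t2 (t1 + 2 * pi) x.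
Proof.
move=> xe n1 n2; have [r [t [r0 ht xE]]] := polar t1 xe.
have incone a : a < t -> t < a + Th -> 0 < side a e x /\ side (a + Th) e x < 0.
  move=> at1 tat; rewrite xE !side_ray; split.
    by apply: mulr_gt0 => //; apply: sin_gt0_pi; wlra.
  rewrite pmulr_rlt0// -oppr_gt0 -sinN; apply: sin_gt0_pi; wlra.
have [tt1|tt1] := eqVneq t t1.
  right; exists r, (t1 + 2 * pi); split => //; first by wlra.
  by rewrite ray_shift -tt1.
have t1t : t1 < t by rewrite lt_neqAle eq_sym tt1; slra.
have [z|z] := ltP t (t1 + Th); first by case: n1; apply: incone.
have [w|w] := leP t t2; first by left; exists r, t; split=> //; wlra.
have [y|y] := ltP t (t2 + Th); first by case: n2; apply: incone.
by right; exists r, t; split=> //; wlra.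
Qed.

(** The two directions differ by at least [Th >= pi / 2] both ways around. *)
Lemma wedge_dot e x y : wedge e t1 t2 x -> wedge e t2 (t1 + 2 * pi) y -> dot e x y <= 0.
Proof.
move=> [r [t [r0 ht ->]]] [s [u [s0 hu ->]]]; rewrite dot_ray pmulr_rle0 ?mulr_gt0//.
by apply: cos_le0_3pihalf; wlra.
Qed.

Lemma wedge_neq e a b x : wedge e a b x -> x != e.
Proof.
move=> [r [t [r0 _ xE]]]; apply/eqP => xe.
have : 0 < dot e x x by rewrite {1 2}xE dot_ray subrr cos0 mulr1 mulr_gt0.
by rewrite xe /dot !subrr !mul0r addr0 ltxx.
Qed.

Lemma wedge_excl e x : wedge e t1 t2 x -> wedge e t2 (t1 + 2 * pi) x -> False.
Proof.
move=> w1 w2; have := dot_gt0 (wedge_neq w1); have := wedge_dot w1 w2; lra.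
Qed.

Lemma wedge_far_side e x : wedge e t2 (t1 + 2 * pi) x -> side t1 e x <= 0.
Proof.
move=> [r [t [r0 ht ->]]]; rewrite side_ray pmulr_rle0//.
by apply: sin_le0_2pi; wlra.
Qed.

Lemma wedge_near_side e x : wedge e t1 t2 x -> 0 <= side (t1 + Th) e x.
Proof.
move=> [r [t [r0 ht ->]]]; rewrite side_ray pmulr_rge0//.
by apply: sin_ge0_pi; wlra.
Qed.

(** The counterclockwise angle from [h] to [g] is between [Th] and [2 * pi - Th]. A positive cross
    product makes it less than [pi], so subtracting [Th] leaves a non-negative sine. *)
Lemma wedge_turn e g h : wedge e t1 t2 g -> wedge e t2 (t1 + 2 * pi) h ->
  0 < cross e h g -> 0 <= circ g h e.
Proof.
move=> [r [t [r0 ht ->]]] [s [u [s0 hu ->]]].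
rewrite crs_ray circ_ray pmulr_rgt0 ?mulr_gt0// pmulr_rge0 ?mulr_gt0//.
have <- : sin (t - u + 2 * pi) = sin (t - u) by exact: sin2pi_shift.
have -> : t - u - Th = (t - u + 2 * pi - Th) - 2 * pi by ring.
rewrite -(sin2pi_shift (_ - 2 * pi)) subrK.
by move=> /sin_gt0_ltpi H; apply: sin_ge0_pi; have := H _; wlra.
Qed.

(** The counterclockwise angle from [h] to [g] is [Th], the least possible between the wedges; it is
    attained only on the two rays of the cone of direction [t1]. *)
Lemma wedge_dir e g h u : (exists2 r, 0 < r & g = ray e r (u + Th)) ->
  (exists2 r, 0 < r & h = ray e r u) ->
  wedge e t1 t2 g -> wedge e t2 (t1 + 2 * pi) h -> same_dir u t1.
Proof.
move=> [r r0 gE] [s s0 hE] [r' [v [r0' hv gE']]] [s' [w [s0' hw hE']]].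
have [_ d1] : r = r' /\ same_dir (u + Th) v by apply: (@ray_inj_dir _ e) => //; rewrite -gE.
have [_ d2] : s = s' /\ same_dir u w by apply: (@ray_inj_dir _ e) => //; rewrite -hE.
have d3 : same_dir (w + Th) v by apply: dir_trans d1; apply: dirD; apply: dir_sym.
have c1 : cos (w + Th - v) = 1.
  by rewrite cosB d3.1 d3.2 -!expr2 cos2Dsin2.
have z : w + Th - v = 2 * pi by apply: cos_eq1_2pi => //; wlra.
have <- : w - 2 * pi = t1 by wlra.
apply: (dir_trans d2); apply: dir_sym.
by have := dir_2pi (w - 2 * pi); rewrite subrK => /dir_sym.
Qed.

End Cross.

(** * Points between two positions on an arc *)

Section Contig.
Variables (R : realType) (Th : R) (G : {fset (R * R)}).
Hypotheses (Thge : pi / 2 <= Th) (Thpi : Th < pi).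
Implicit Types (t u : R) (p q k g h x y e : R * R).
Ltac tlra := move: (@pi_gt0 R) (Thge) (Thpi) => ? ? ?; slra.

(** The side conditions put [q] in the closed cone opposite to the one spanned by [h] and [g]. There
    the pair is seen under an angle less than [Th], except from the apex. *)
Lemma apex_of_turn g h u q : 0 < side u h g -> side (u + Th) g h < 0 ->
  side u h q <= 0 -> 0 <= side (u + Th) g q ->
  (0 < cross q h g -> 0 <= circ Th g h q) -> q = apex Th g h u.
Proof.
move=> s1 s2; have sT := sinTh_gt0 Thge Thpi; have cT := cosTh_le0 Thge Thpi.
have [r r0 hE] := apex_ray_r Thge Thpi s2.
have [m m0 gE] := apex_ray_l Thge Thpi s1.
rewrite -(apex_r Th g) -(apex_l Thge Thpi _ h).
set P := apex Th g h u in hE gE *.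
move=> q1 q2.
(* [a] and [b] are the coordinates of [P - q] along the two rays. *)
pose b := - side u P q / sin Th; pose a := side (u + Th) P q / sin Th.
have b0 : 0 <= b by rewrite divr_ge0 ?oppr_ge0// ltW.
have a0 : 0 <= a by rewrite divr_ge0// ltW.
have cs := cos2Dsin2 u.
pose X := (P.1 - a * cos u - b * cos (u + Th), P.2 - a * sin u - b * sin (u + Th)).
have bE : b * sin Th = - side u P q by rewrite /b divfK// gt_eqF.
have aE : a * sin Th = side (u + Th) P q by rewrite /a divfK// gt_eqF.
have X1 : side u P X = - (b * sin Th).
  transitivity (- (b * sin Th * (cos u ^+ 2 + sin u ^+ 2))); last by rewrite cs mulr1.
  by rewrite /side /X /= cosD sinD; ring.
have X2 : side (u + Th) P X = a * sin Th.
  transitivity (a * sin Th * (cos u ^+ 2 + sin u ^+ 2)); last by rewrite cs mulr1.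
  by rewrite /side /X /= cosD sinD; ring.
have qE : q = X.
  apply: (sides_inj Thge Thpi (t := u)).
    by have := sideD u P X q; rewrite X1 bE; lra.
  by have := sideD (u + Th) P X q; rewrite X2 aE; lra.
have CE : cross q h g = sin Th * ((r + a) * (m + b) - a * b).
  rewrite hE gE qE /X /cross /ray /= cosD sinD.
  transitivity ((cos u ^+ 2 + sin u ^+ 2) * sin Th * ((r + a) * (m + b) - a * b)); first by ring.
  by rewrite cs mul1r.
have DE : dot q h g = (r + a) * a + b * (m + b) + cos Th * ((r + a) * (m + b) + a * b).
  rewrite hE gE qE /X /dot /ray /=.
  have cs' := cos2Dsin2 (u + Th).
  have cT' : cos (u + Th) * cos u + sin (u + Th) * sin u = cos Th.
    by rewrite -cosB; congr cos; ring.
  transitivity ((r + a) * a * (cos u ^+ 2 + sin u ^+ 2) + b * (m + b) * (cos (u + Th) ^+ 2 + sin (u + Th) ^+ 2)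
    + (cos (u + Th) * cos u + sin (u + Th) * sin u) * ((r + a) * (m + b) + a * b)); first by ring.
  by rewrite cs cs' cT' !mulr1.
(* Each summand of the last factor is non-negative, so [circ] can only be non-negative at [q] if
   [a = b = 0]. *)
have FE : circ Th g h q = - (sin Th * (b * m + a * r + (a ^+ 2 + b ^+ 2 + 2 * cos Th * a * b))).
  by rewrite /circ CE DE; ring.
have ab : 0 < cross q h g.
  rewrite CE mulr_gt0//; have := mulr_gt0 r0 m0; have := mulr_ge0 (ltW r0) b0.
  by have := mulr_ge0 a0 (ltW m0); lra.
move=> /(_ ab); rewrite FE oppr_ge0 pmulr_rle0// => F0.
have quadf : 0 <= a ^+ 2 + b ^+ 2 + 2 * cos Th * a * b.
  have -> : a ^+ 2 + b ^+ 2 + 2 * cos Th * a * b = (a + cos Th * b) ^+ 2 + b ^+ 2 * (1 - cos Th ^+ 2) by ring.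
  by rewrite -sin2cos2 -exprMn addr_ge0// sqr_ge0.
have ar := mulr_ge0 a0 (ltW r0); have bm := mulr_ge0 b0 (ltW m0).
have a00 : a = 0 by apply: (mulIf (lt0r_neq0 r0)); rewrite mul0r; lra.
have b00 : b = 0 by apply: (mulIf (lt0r_neq0 m0)); rewrite mul0r; lra.
by rewrite qE /X a00 b00 !mul0r !subr0 -surjective_pairing.
Qed.

Lemma between_zero (f k : R -> R) a b : continuous f -> continuous k ->
  f a <= 0 -> 0 <= k b ->
  (forall u, Num.min a b <= u <= Num.max a b -> ~ (0 < f u /\ k u < 0)) ->
  exists2 u, Num.min a b <= u <= Num.max a b & f u <= 0 /\ 0 <= k u.
Proof.
move=> cf ck fa kb H.
(* [F] is twice the positive part of [f] minus twice the negative part of [k]. By [H] the two parts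
   are never both nonzero, so both vanish at a zero of [F]. *)
pose F u := f u + `|f u| + (k u - `|k u|).
have cF : continuous F.
  move=> u; apply: cvgD.
    by apply: cvgD; [exact: cf|apply: cvg_norm; exact: cf].
  by apply: cvgB; [exact: ck|apply: cvg_norm; exact: ck].
have Fa : F a <= 0.
  by rewrite /F (ler0_norm fa) addrN add0r subr_le0 ler_norm.
have Fb : 0 <= F b.
  by rewrite /F (ger0_norm kb) subrr addr0; have := ler_norm (- f b); rewrite normrN; lra.
have cF' (x y : R) : {within `[x, y], continuous F}.
  by apply: continuous_subspaceT => ?; exact: cF.
have [u hu Fu] : exists2 u, Num.min a b <= u <= Num.max a b & F u = 0.
  have [ab|/ltW ba] := leP a b.
    have [|u hu Fu] := @IVT R F a b 0 ab (cF' a b).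
      by rewrite ge_min le_max Fa Fb orbT.
    by exists u.
  have [|u hu Fu] := @IVT R F b a 0 ba (cF' b a).
    by rewrite ge_min le_max Fa Fb orbT.
  by exists u.
exists u => //.
move: Fu; rewrite /F => Fu.
have nH := H u hu.
have [f0|f0] := leP (f u) 0; have [k0|k0] := leP 0 (k u).
- by [].
- by move: Fu; rewrite (ler0_norm f0) (ltr0_norm k0); lra.
- by move: Fu; rewrite (gtr0_norm f0) (ger0_norm k0); lra.
- by case: nH.
Qed.

(* While the cone rotates from [e] to [e''], [e'] is never inside it.  It starts
   on the right of the right line and ends on the left of the left line, so at
   some moment both hold; as [h] and [g] span an angle >= Th at [e'], the apex
   is then [e']. *)
Lemma contig e t1 t2 e' t1' t2' e'' t1'' t2'' g h a b :
  t1 + Th <= t2 -> t2 + Th <= t1 + 2 * pi ->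
  t1' + Th <= t2' -> t2' + Th <= t1' + 2 * pi ->
  t1'' + Th <= t2'' -> t2'' + Th <= t1'' + 2 * pi ->
  same_dir t1 a -> same_dir t1'' b -> apex Th g h a = e -> apex Th g h b = e'' ->
  (forall u, Num.min a b <= u <= Num.max a b -> tight Th G g h u) ->
  boundary (theta_region G Th) e' ->
  wedge Th e t2 (t1 + 2 * pi) e' -> wedge Th e'' t1'' t2'' e' ->
  wedge Th e' t1' t2' g -> wedge Th e' t2' (t1' + 2 * pi) h ->
  exists u, [/\ Num.min a b <= u <= Num.max a b, apex Th g h u = e' & same_dir u t1'].
Proof.
move=> h1 h2 h1' h2' h1'' h2'' da db ae ae'' Ht be' w w'' wg wh.
have [|||||u hu [f0 k0]] := @between_zero (fun u => side u h e') (fun u => side (u + Th) g e') a b.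
- exact: side_acont0.
- exact: side_acont.
- rewrite -(apex_r Th g) ae -(dir_side _ _ da); exact: wedge_far_side w.
- rewrite -(apex_l Thge Thpi _ h) ae'' -(dir_side _ _ (dirD Th db)).
  exact: wedge_near_side w''.
- move=> u hu; have := boundary_not_in_cone Thge Thpi be' (tight_emp Thge Thpi (Ht u hu)).
  by rewrite apex_r apex_l.
have [_ _ s1 s2 _] := Ht u hu.
have eE : e' = apex Th g h u.
  apply: apex_of_turn => //.
  exact: wedge_turn wg wh.
exists u; split=> //.
apply: wedge_dir wg wh => //.
  by have := apex_ray_l Thge Thpi s1; rewrite eE.
by have := apex_ray_r Thge Thpi s2; rewrite eE.
Qed.

End Contig.

(** * Counting elements of chains *)

Section Counting.

Lemma size_inj_in (T U : eqType) (f : T -> U) (s : seq T) (t : seq U) :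
  uniq s -> {in s &, injective f} -> (forall x, x \in s -> f x \in t) ->
  (size s <= size t)%N.
Proof.
move=> us fi ft; rewrite -(size_map f); apply: uniq_leq_size.
  by rewrite map_inj_in_uniq.
by move=> y /mapP[x xs ->]; exact: ft.
Qed.

Lemma size_rel_in (T : eqType) (U : choiceType) (Q : T -> U -> Prop) (s : seq T) (t : seq U) :
  uniq s -> (forall x, x \in s -> exists2 y, y \in t & Q x y) ->
  (forall x x' y, x \in s -> x' \in s -> Q x y -> Q x' y -> x = x') ->
  (size s <= size t)%N.
Proof.
case: t => [|y0 t] us H inj.
  case: s us H inj => // x s _ H _.
  by have [] := H x (mem_head _ _).
have /choice[f fH] : forall x, exists y, x \in s -> y \in y0 :: t /\ Q x y.
  move=> x.
  have [xs|xs] := boolP (x \in s); last by exists y0.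
  by have [y yt Qy] := H x xs; exists y.
apply: (@size_inj_in _ _ f) => //; last by move=> x /fH[].
move=> x x' xs xs' e; apply: (inj _ _ (f x)) => //; first by case: (fH x xs).
by rewrite e; case: (fH x' xs').
Qed.

Lemma seq_argmin (R : realType) (T : eqType) (f : T -> R) (s : seq T) (x : T) : x \in s ->
  exists2 m, m \in s & forall y, y \in s -> f m <= f y.
Proof.
elim: s x => [//|a s IH] x _.
case: s IH => [|b s] IH.
  by exists a; rewrite ?mem_head// => y; rewrite inE => /eqP ->.
have [m ms mH] := IH b (mem_head _ _).
have [am|ma] := leP (f a) (f m).
  exists a; rewrite ?mem_head// => y; rewrite inE => /orP[/eqP ->//|/mH].
  exact: le_trans.
exists m; first by rewrite inE ms orbT.
by move=> y; rewrite inE => /orP[/eqP ->|/mH//]; exact: ltW.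
Qed.

(* Send each [e] to its nearest successor for [lt].  Elements without successor
   inject into [Gs]; those whose successor leaves one of the two classes inject
   into [D]; the remaining ones inject, by their successors, into the others. *)
Lemma chain_count (R : realType) (T U V : choiceType) (X : seq T) (Gs : seq U) (D : seq V)
    (lt : T -> T -> Prop) (L : T -> U -> Prop) (K : bool -> V -> T -> Prop) (dist : T -> U -> R) :
  uniq X ->
  (forall e, e \in X -> exists2 g, g \in Gs & L e g) ->
  (forall e e' g, e \in X -> e' \in X -> e != e' -> L e g -> L e' g -> lt e e' \/ lt e' e) ->
  (forall e e' g, e \in X -> e' \in X -> lt e e' -> L e g -> L e' g /\ dist e g < dist e' g) ->
  (forall b e, e \in X -> exists2 y, y \in D & K b y e) ->
  (forall b y e e', e \in X -> e' \in X -> K b y e -> K b y e' -> exists g, L e g /\ L e' g) ->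
  (forall b y e e' e'', e \in X -> e' \in X -> e'' \in X -> lt e e' -> lt e' e'' ->
     K b y e -> K b y e'' -> K b y e') ->
  (forall e e' e'', e \in X -> e' \in X -> e'' \in X -> e != e' -> e != e'' -> e' != e'' ->
     (forall b, exists2 y, K b y e & K b y e') -> (forall b, exists2 y, K b y e & K b y e'') -> False) ->
  (size X <= 2 * (size Gs + 2 * size D))%N.
Proof.
move=> uX HL Hcmp Hlt HD Hk Hc H3.
have [->//|[x0 x0X]] : X = [::] \/ exists x, x \in X.
  by case: (X) => [|x s]; [left|right; exists x; rewrite mem_head].
have [u0 _ _] := HL _ x0X.
have /choice[ga gaP] : forall e, exists g, e \in X -> g \in Gs /\ L e g.
  move=> e.
  have [eX|eX] := boolP (e \in X); last by exists u0.
  by have [g gG Lg] := HL e eX; exists g.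
have [y0 _ _] := HD true _ x0X.
have /choice[k kP] : forall z : bool * T, exists y, z.2 \in X -> y \in D /\ K z.1 y z.2.
  move=> [b e] /=; have [eX|eX] := boolP (e \in X); last by exists y0.
  by have [y yD Ky] := HD b e eX; exists y.
(* [s e] is the successor of [e] nearest to [ga e], or [None] if there is no successor. *)
have /choice[s sP] : forall e, exists o, e \in X -> match o with
    | None => forall e', e' \in X -> ~ lt e e'
    | Some m => [/\ m \in X, lt e m & forall e', e' \in X -> lt e e' -> dist m (ga e) <= dist e' (ga e)]
    end.
  move=> e.
  have [N|] := pselect (forall e', e' \in X -> ~ lt e e'); first by exists None.
  move=> /existsNP[e1 /not_implyP[e1X /contrapT lt1]].
  have : e1 \in [seq e' <- X | `[< lt e e' >]] by rewrite mem_filter e1X andbT; apply/asboolP.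
  move=> /(@seq_argmin R _ (fun m => dist m (ga e)))[m].
  rewrite mem_filter => /andP[/asboolP ltm mX] mH.
  exists (Some m) => _; split=> // e' e'X lte'; apply: mH.
  by rewrite mem_filter e'X andbT; apply/asboolP.
have asym e e' : e \in X -> e' \in X -> lt e e' -> ~ lt e' e.
  move=> eX e'X l1 l2; have [_ Lg] := gaP e eX.
  have [Lg' d1] := Hlt _ _ _ eX e'X l1 Lg.
  by have [_ d2] := Hlt _ _ _ e'X eX l2 Lg'; lra.
have irr e : e \in X -> ~ lt e e by move=> eX l; exact: (asym e e eX eX l).
(* Every element has no successor ([rt]), a successor outside its class [b] ([ch b]), or a successor
   in both of its classes ([sm]). *)
pose rt e := s e == None.
pose ch b e := if s e is Some m then ~~ `[< K b (k (b, e)) m >] else false.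
pose sm e := if s e is Some m then `[< K true (k (true, e)) m >] && `[< K false (k (false, e)) m >] else false.
have nrt : (count rt X <= size Gs)%N.
  rewrite -size_filter; apply: (@size_inj_in _ _ ga); first by rewrite filter_uniq.
    move=> e e'; rewrite !mem_filter => /andP[/eqP r eX] /andP[/eqP r' e'X] gg.
    apply/eqP; apply: contrapT => /negP ee.
    have [_ Le] := gaP e eX; have [_ Le'] := gaP e' e'X; rewrite -gg in Le'.
    have := sP e eX; have := sP e' e'X; rewrite r r' => n' n.
    by case: (Hcmp e e' _ eX e'X ee Le Le') => [/(n _ e'X)|/(n' _ eX)].
  by move=> e; rewrite mem_filter => /andP[_ /gaP[]].
have nch b : (count (ch b) X <= size D)%N.
  rewrite -size_filter; apply: (@size_inj_in _ _ (fun e => k (b, e))); first by rewrite filter_uniq.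
    (* If [e] and a later [e'] have the same class, the successor of [e] is [e'] or lies between
       them, hence belongs to this class by convexity. *)
    suff main e e' : e \in X -> e' \in X -> ch b e -> k (b, e) = k (b, e') -> lt e e' -> False.
      move=> e e'; rewrite !mem_filter => /andP[r eX] /andP[r' e'X] kk.
      apply/eqP; apply: contrapT => /negP ee.
      have [_ Ke] := kP (b, e) eX; have [_ Ke'] := kP (b, e') e'X.
      rewrite /= -kk in Ke Ke'.
      have [g [Lg Lg']] := Hk b _ e e' eX e'X Ke Ke'.
      by case: (Hcmp e e' g eX e'X ee Lg Lg') => l; [apply: (main e e')|apply: (main e' e)].
    move=> eX e'X; rewrite /ch; have := sP e eX; case: (s e) => // m [mX ltm mH] ne kk lte.
    have [_ Ke] := kP (b, e) eX; have [_ Ke'] := kP (b, e') e'X.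
    rewrite /= -kk in Ke Ke'; move/asboolP: ne => ne.
    have [_ Le] := gaP e eX.
    have [em|em] := eqVneq m e'; first by apply: ne; rewrite em.
    have [Lm _] := Hlt _ _ _ eX mX ltm Le; have [Le' _] := Hlt _ _ _ eX e'X lte Le.
    case: (Hcmp m e' _ mX e'X em Lm Le') => l.
      by apply: ne; apply: (Hc b _ e m e' eX mX e'X ltm l Ke).
    have [_] := Hlt _ _ _ e'X mX l Le'.
    by have := mH e' e'X lte; lra.
  by move=> e; rewrite mem_filter => /andP[_ eX]; case: (kP (b, e) eX).
have cover e : e \in X -> ~~ sm e -> [|| rt e, ch true e | ch false e].
  rewrite /rt /ch /sm => eX; case: (s e) => [m|//]; rewrite negb_and => /orP[->|->]//.
  by rewrite !orbT.
(* The successor map is injective on [sm] and leads out of [sm]: otherwise one element would share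
   both classes with two others, against [H3]. *)
have nsm : (count sm X <= count (predC sm) X)%N.
  rewrite -!size_filter; apply: (@size_inj_in _ _ (fun e => odflt e (s e))).
  - by rewrite filter_uniq.
  - move=> e e'; rewrite !mem_filter /sm => /andP[+ eX] /andP[+ e'X].
    have := sP e eX; have := sP e' e'X; case: (s e) => [m|//]; case: (s e') => [m'|//] /=.
    move=> [m'X lt' _] [mX lte _] /andP[/asboolP k1 /asboolP k2] /andP[/asboolP k1' /asboolP k2'] mm.
    rewrite -mm in lt' k1' k2'.
    apply/eqP; apply: contrapT => /negP ee.
    have nem : e != m by apply/eqP => E; apply: (irr e eX); rewrite {2}E.
    have nem' : e' != m by apply/eqP => E; apply: (irr e' e'X); rewrite {2}E.
    apply: (H3 m e e') => //; rewrite 1?eq_sym//.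
      by case; [exists (k (true, e)) => //; case: (kP (true, e) eX)|exists (k (false, e)) => //; case: (kP (false, e) eX)].
    by case; [exists (k (true, e')) => //; case: (kP (true, e') e'X)|exists (k (false, e')) => //; case: (kP (false, e') e'X)].
  - move=> e; rewrite !mem_filter /sm => /andP[+ eX].
    have := sP e eX; case E: (s e) => [m|//] /= [mX lte _] /andP[/asboolP k1 /asboolP k2].
    rewrite mX andbT /=; have := sP m mX; case: (s m) => [m'|//] [m'X ltm _].
    apply/negP => /andP[/asboolP k1' /asboolP k2'].
    have [_ Le] := gaP e eX.
    have [Lm d1] := Hlt _ _ _ eX mX lte Le.
    have [Lm' d2] := Hlt _ _ _ mX m'X ltm Lm.
    apply: (H3 m e m') => //.
    + by apply: contraTneq d1 => ->; rewrite ltxx.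
    + by apply: contraTneq d2 => ->; rewrite ltxx.
    + by apply/eqP => E'; move: d2; rewrite -E'; lra.
    + by case; [exists (k (true, e)) => //; case: (kP (true, e) eX)|exists (k (false, e)) => //; case: (kP (false, e) eX)].
    + by case; [exists (k (true, m)) => //; case: (kP (true, m) mX)|exists (k (false, m)) => //; case: (kP (false, m) mX)].
have npc : (count (predC sm) X <= size Gs + 2 * size D)%N.
  apply: (@leq_trans (count (predU rt (predU (ch true) (ch false))) X)).
    rewrite -!size_filter; apply: uniq_leq_size; first by rewrite filter_uniq.
    by move=> e; rewrite !mem_filter => /andP[/= n eX]; rewrite eX andbT; apply: cover.
  have h1 := count_predUI rt (predU (ch true) (ch false)) X.
  have h2 := count_predUI (ch true) (ch false) X.
  have h3 := nch true; have h4 := nch false.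
  by lia.
by rewrite -(count_predC sm X) mul2n -addnn leq_add //; exact: leq_trans nsm npc.
Qed.

End Counting.

(** * Common points of two circles *)

Section Circles.
Variables (R : realType) (Th : R).
Hypotheses (Thge : pi / 2 <= Th) (Thpi : Th < pi).
Implicit Types (t u : R) (p q k g h x y e : R * R).
Ltac tlra := move: (@pi_gt0 R) (Thge) (Thpi) => ? ? ?; slra.

(** Expansion about [e]. The quadratic part does not depend on the pair, so the difference of two
    such functions is affine. *)
Lemma circ_expand g h e q : circ Th g h q = circ Th g h e
  + (cos Th * (h.2 - g.2) + sin Th * (h.1 + g.1 - 2 * e.1)) * (q.1 - e.1)
  + (cos Th * (g.1 - h.1) + sin Th * (h.2 + g.2 - 2 * e.2)) * (q.2 - e.2)
  - sin Th * ((q.1 - e.1) ^+ 2 + (q.2 - e.2) ^+ 2).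
Proof. by rewrite /circ /cross /dot; ring. Qed.

Lemma neq_sqr_gt0 p q : p != q -> 0 < (p.1 - q.1) ^+ 2 + (p.2 - q.2) ^+ 2.
Proof. by move=> /dot_gt0; rewrite /dot !expr2. Qed.

(** The difference is affine and vanishes at three points, which are not collinear because no line
    meets a circle in three points. *)
Lemma circ_three g h g' h' e e' e'' : e != e' -> e != e'' -> e' != e'' ->
  (forall q, q \in [:: e; e'; e''] -> circ Th g h q = 0 /\ circ Th g' h' q = 0) ->
  forall q, circ Th g h q = circ Th g' h' q.
Proof.
move=> n1 n2 n3 H q; have sT := sinTh_gt0 Thge Thpi.
have [a1 b1] := H e (mem_head _ _).
have [a2 b2] : circ Th g h e' = 0 /\ circ Th g' h' e' = 0 by apply: H; rewrite !inE eqxx orbT.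
have [a3 b3] : circ Th g h e'' = 0 /\ circ Th g' h' e'' = 0 by apply: H; rewrite !inE eqxx !orbT.
rewrite (circ_expand g h e q) (circ_expand g' h' e q) a1 b1.
move: a2 b2 a3 b3; rewrite (circ_expand g h e e') (circ_expand g' h' e e').
rewrite (circ_expand g h e e'') (circ_expand g' h' e e'') a1 b1 !add0r.
rewrite eq_sym in n1; rewrite eq_sym in n2.
have m1 := neq_sqr_gt0 n1; have m2 := neq_sqr_gt0 n2; have m3 := neq_sqr_gt0 n3.
set L1 := _ + sin Th * (h.1 + _ - _); set L2 := _ + sin Th * (h.2 + _ - _).
set M1 := _ + sin Th * (h'.1 + _ - _); set M2 := _ + sin Th * (h'.2 + _ - _).
have m3' : 0 < (e'.1 - e.1 - (e''.1 - e.1)) ^+ 2 + (e'.2 - e.2 - (e''.2 - e.2)) ^+ 2.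
  by have := m3; congr (_ < _); ring.
move: m1 m2 m3'; set x := e'.1 - e.1; set y := e'.2 - e.2; set X := e''.1 - e.1; set Y := e''.2 - e.2.
move=> m1 m2 m3' a2 b2 a3 b3.
have z1 : (L1 - M1) * x + (L2 - M2) * y = 0 by lra.
have z2 : (L1 - M1) * X + (L2 - M2) * Y = 0 by lra.
have [D0|D0] := eqVneq (x * Y - y * X) 0; last first.
  have LM1 : L1 - M1 = 0.
    apply: (mulIf D0); rewrite mul0r.
    transitivity (((L1 - M1) * x + (L2 - M2) * y) * Y - ((L1 - M1) * X + (L2 - M2) * Y) * y); first by ring.
    by rewrite z1 z2; ring.
  have LM2 : L2 - M2 = 0.
    apply: (mulIf D0); rewrite mul0r.
    transitivity (((L1 - M1) * X + (L2 - M2) * Y) * x - ((L1 - M1) * x + (L2 - M2) * y) * X); first by ring.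
    by rewrite z1 z2; ring.
  have -> : L1 = M1 by lra.
  by have -> : L2 = M2 by lra.
(* In the collinear case the equations force [e'] and [e''] to coincide. *)
exfalso.
have e1 : L1 * x + L2 * y = sin Th * (x ^+ 2 + y ^+ 2) by lra.
have e2 : L1 * X + L2 * Y = sin Th * (X ^+ 2 + Y ^+ 2) by lra.
have d1 : X ^+ 2 + Y ^+ 2 = x * X + y * Y.
  have nz : sin Th * (x ^+ 2 + y ^+ 2) != 0 by rewrite mulf_neq0 ?gt_eqF.
  apply: (mulfI nz).
  transitivity ((x ^+ 2 + y ^+ 2) * (L1 * X + L2 * Y)); first by rewrite e2; ring.
  transitivity ((x * X + y * Y) * (L1 * x + L2 * y) + (x * Y - y * X) * (L2 * x - L1 * y)); first by ring.
  by rewrite D0 e1; ring.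
have d2 : x ^+ 2 + y ^+ 2 = x * X + y * Y.
  have nz : sin Th * (X ^+ 2 + Y ^+ 2) != 0 by rewrite mulf_neq0 ?gt_eqF.
  apply: (mulfI nz).
  transitivity ((X ^+ 2 + Y ^+ 2) * (L1 * x + L2 * y)); first by rewrite e1; ring.
  transitivity ((x * X + y * Y) * (L1 * X + L2 * Y) + (x * Y - y * X) * (L1 * Y - L2 * X)); first by ring.
  by rewrite D0 e2; ring.
have : (x - X) ^+ 2 + (y - Y) ^+ 2 = (x ^+ 2 + y ^+ 2) + (X ^+ 2 + Y ^+ 2) - 2 * (x * X + y * Y) by ring.
by rewrite d1 d2 => E; move: m3'; rewrite E; lra.
Qed.

Lemma cos_le0_neg t : - (3 * (pi / 2)) <= t <= - (pi / 2) -> cos t <= 0.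
Proof. by move=> ht; rewrite -cosN; apply: cos_le0_3pihalf; slra. Qed.

(* All four rays would lie in an open half-plane (they are chords of one circle
   through [e]), but two disjoint cones of angle Th >= pi/2 do not fit there. *)
Lemma circ_neq e t1 t2 g h g' h' : t1 + Th <= t2 -> t2 + Th <= t1 + 2 * pi ->
  (exists2 r, 0 < r & h = ray e r t1) -> (exists2 r, 0 < r & g = ray e r (t1 + Th)) ->
  (exists2 r, 0 < r & h' = ray e r t2) -> (exists2 r, 0 < r & g' = ray e r (t2 + Th)) ->
  (forall q, circ Th g h q = circ Th g' h' q) -> False.
Proof.
move=> H1 H2 hr gr hr' gr' eqC.
have sT := sinTh_gt0 Thge Thpi.
have ce : circ Th g h e = 0.
  case: hr gr => r r0 -> [s s0 ->]; rewrite circ_ray.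
  have -> : t1 + Th - t1 - Th = 0 by ring.
  by rewrite sin0 mulr0.
have cr g0 h0 : circ Th g0 h0 h0 = 0 by rewrite /circ /cross /dot; ring.
have cl g0 h0 : circ Th g0 h0 g0 = 0 by rewrite /circ /cross /dot; ring.
(* [L] is the gradient of [circ Th g h] at [e]; every other point of the circle lies strictly on its
   positive side. *)
pose L := (cos Th * (h.2 - g.2) + sin Th * (h.1 + g.1 - 2 * e.1),
  cos Th * (g.1 - h.1) + sin Th * (h.2 + g.2 - 2 * e.2)).
have Lpos x t : circ Th g h x = 0 -> (exists2 r, 0 < r & x = ray e r t) ->
    0 < L.1 * cos t + L.2 * sin t.
  rewrite (circ_expand g h e x) ce => cx [r r0 xE].
  have cs := cos2Dsin2 t.
  have : r * (L.1 * cos t + L.2 * sin t) = sin Th * r ^+ 2.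
    move: cx; rewrite xE /ray /= => cx.
    transitivity (sin Th * (r ^+ 2 * (cos t ^+ 2 + sin t ^+ 2))); last by rewrite cs mulr1.
    rewrite /L /=.
    by apply/eqP; rewrite -subr_eq0; apply/eqP; rewrite -[RHS]cx; ring.
  by rewrite -(pmulr_rgt0 _ r0) => ->; rewrite mulr_gt0// exprn_gt0.
have p1 := Lpos _ _ (cr g h) hr.
have p2 := Lpos _ _ (cl g h) gr.
have p3 : 0 < L.1 * cos t2 + L.2 * sin t2 by apply: Lpos hr'; rewrite eqC cr.
have p4 : 0 < L.1 * cos (t2 + Th) + L.2 * sin (t2 + Th) by apply: Lpos gr'; rewrite eqC cl.
have L0 : L != (0, 0) by apply: contraTneq p1 => ->; rewrite /= !mul0r addr0 ltxx.
have [r [z [r0 hz LE]]] := polar t1 L0.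
have Lt t : L.1 * cos t + L.2 * sin t = r * cos (z - t).
  by rewrite LE /ray cosB /=; ring.
rewrite !Lt !pmulr_rgt0// in p1 p2 p3 p4.
have A1 := @cos_le0_3pihalf R (z - t1).
have A2 := @cos_le0_3pihalf R (z - (t1 + Th)).
have A2' := @cos_le0_neg (z - (t1 + Th)).
have A3 := @cos_le0_neg (z - t2).
have A4 := @cos_le0_neg (z - (t2 + Th)).
have c1 : z - t1 < pi / 2 \/ 3 * (pi / 2) < z - t1.
  have [c|c] := ltP (z - t1) (pi / 2); [by left|right; rewrite ltNge; apply/negP => c'].
  by have : cos (z - t1) <= 0 by [apply: A1; slra]; lra.
have c2 : - (pi / 2) < z - (t1 + Th).
  rewrite ltNge; apply/negP => c; have : cos (z - (t1 + Th)) <= 0; last lra.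
  by apply: A2'; tlra.
have c2' : z - (t1 + Th) < pi / 2.
  rewrite ltNge; apply/negP => c; have : cos (z - (t1 + Th)) <= 0; last lra.
  by apply: A2; tlra.
have c1' : z - t1 < pi / 2 by case: c1 => // c; tlra.
have c3 : - (pi / 2) < z - t2.
  rewrite ltNge; apply/negP => c; have : cos (z - t2) <= 0; last lra.
  by apply: A3; tlra.
have : cos (z - (t2 + Th)) <= 0; last lra.
by apply: A4; tlra.
Qed.

End Circles.

(** * The number of points with two empty cones *)

Section Crossings.
Variables (R : realType) (Th : R) (G : {fset (R * R)}).
Hypotheses (Thge : pi / 2 <= Th) (Thpi : Th < pi).
Implicit Types (t u : R) (p q k g h x y e : R * R).
Ltac tlra := move: (@pi_gt0 R) (Thge) (Thpi) => ? ? ?; slra.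
Let A := theta_region G Th.

Definition touches p t := exists g h, tight Th G g h t /\ apex Th g h t = p.

(** The fixed guard [g0] decides which of the two wedges comes second; L(e) consists of the guards
    in the first. *)
Definition crossing g0 p t1 t2 :=
  [/\ boundary A p, t1 + Th <= t2 /\ t2 + Th <= t1 + 2 * pi,
      wedge Th p t2 (t1 + 2 * pi) g0, touches p t1 & touches p t2].

Lemma tight_rays g h t : tight Th G g h t ->
  (exists2 r, 0 < r & h = ray (apex Th g h t) r t) /\
  (exists2 r, 0 < r & g = ray (apex Th g h t) r (t + Th)).
Proof.
by move=> [_ _ s1 s2 _]; split; [exact: apex_ray_r|exact: apex_ray_l].
Qed.

Lemma touches_emp p t : touches p t -> empty_cone Th G p t.
Proof. by move=> [g [h [T <-]]]; exact: tight_emp. Qed.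

Lemma touches_notin p t : touches p t -> p \notin G.
Proof. by move=> [g [h [T <-]]]; exact: tight_apex_notin. Qed.

Lemma tight_pair_uniq g h g' h' t : tight Th G g h t -> tight Th G g' h' t ->
  apex Th g h t = apex Th g' h' t -> g = g' /\ h = h'.
Proof.
move=> T T' E; have [gG hG s1 s2 H] := T; have [gG' hG' s1' s2' H'] := T'.
have e1 x : side t h x = side t h' x by rewrite -(apex_r Th g h) E apex_r.
have e2 x : side (t + Th) g x = side (t + Th) g' x.
  by rewrite -(apex_l Thge Thpi g h) E apex_l.
split; apply/eqP; apply: contrapT => /negP n; rewrite eq_sym in n.
  have gh : g' != h by apply: contraTneq s1' => ->; rewrite -e1 side_id ltxx.
  by have [] := H g' gG' n gh; rewrite ?e1 ?e2 ?side_id; lra.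
have gh : h' != g by apply: contraTneq s2' => ->; rewrite -e2 side_id ltxx.
by have [] := H h' hG' gh n; rewrite ?e1 ?e2 ?side_id; lra.
Qed.

Lemma circ_apex g h t : tight Th G g h t -> circ Th g h (apex Th g h t) = 0.
Proof.
move=> /tight_rays; move: (apex _ _ _ _) => p [[r r0 ->] [s s0 ->]].
rewrite circ_ray; have -> : t + Th - t - Th = 0 by ring.
by rewrite sin0 mulr0.
Qed.

(** Hence, for [e != e'], the angles at [e] and [e'] of a triangle with [g] are not both at least
    [pi / 2]. *)
Lemma dot_sum e e' g : dot e e' g + dot e' e g = dot e e' e'.
Proof. by rewrite /dot; ring. Qed.

Lemma dotC e x y : dot e x y = dot e y x.
Proof. by rewrite /dot; ring. Qed.

Lemma wedge_shift p a b x : wedge Th p a b x -> wedge Th p (a + 2 * pi) (b + 2 * pi) x.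
Proof.
move=> [r [t [r0 ht ->]]]; exists r, (t + 2 * pi); split=> //; first by slra.
by rewrite ray_shift.
Qed.

Lemma touches_dir p t u : same_dir t u -> touches p t -> touches p u.
Proof.
move=> d [g [h [T E]]]; exists g, h; split; first exact: (dir_tight d).
by rewrite -(dir_apex _ _ _ d).
Qed.

(** For [n] guards, [chain_count] with the [12 * n] keys as names of classes gives
    [2 * (n + 2 * (12 * n))]. *)
Lemma size_crossings g0 (X : seq (R * R)) : g0 \in G -> uniq X ->
  (forall p, p \in X -> exists t1 t2, crossing g0 p t1 t2) ->
  (size X <= 50 * #|` G|)%N.
Proof.
move=> g0G uX HX.
have /choice[T TP] : forall p, exists t : R * R, p \in X -> crossing g0 p t.1 t.2.
  move=> p; have [pX|pX] := boolP (p \in X); last by exists (0, 0).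
  by have [t1 [t2 c]] := HX p pX; exists (t1, t2).
pose t1 p := (T p).1; pose t2 p := (T p).2.
pose W1 e x := wedge Th e (t1 e) (t2 e) x.
pose W2 e x := wedge Th e (t2 e) (t1 e + 2 * pi) x.
have bd e : e \in X -> boundary A e by move=> /TP[].
have le12 e : e \in X -> t1 e + Th <= t2 e /\ t2 e + Th <= t1 e + 2 * pi by move=> /TP[].
have W20 e : e \in X -> W2 e g0 by move=> /TP[].
have to1 e : e \in X -> touches e (t1 e) by move=> /TP[].
have to2 e : e \in X -> touches e (t2 e) by move=> /TP[].
have notG e : e \in X -> e \notin G by move=> /to1/touches_notin.
have coverG e g : e \in X -> g \in G -> W1 e g \/ W2 e g.
  move=> eX gG; have [l1 l2] := le12 e eX.
  apply: (wedge_cover Thge Thpi) => //.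
  - by apply: contraNneq (notG e eX) => <-.
  - exact: touches_emp (to1 e eX) _ gG.
  - exact: touches_emp (to2 e eX) _ gG.
have coverX e e' : e \in X -> e' \in X -> e != e' -> W1 e e' \/ W2 e e'.
  move=> eX eX' n; have [l1 l2] := le12 e eX.
  apply: (wedge_cover Thge Thpi) => //.
  - by rewrite eq_sym.
  - exact: (boundary_not_in_cone Thge Thpi (bd e' eX') (touches_emp (to1 e eX))).
  - exact: (boundary_not_in_cone Thge Thpi (bd e' eX') (touches_emp (to2 e eX))).
have wdot e x y : e \in X -> W1 e x -> W2 e y -> dot e x y <= 0.
  by move=> eX; have [l1 l2] := le12 e eX; exact: wedge_dot.
have wexcl e x : e \in X -> W1 e x -> W2 e x -> False.
  by move=> eX; have [l1 l2] := le12 e eX; exact: wedge_excl.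
(* Later points are on the side of [g0] as seen from earlier ones. *)
pose lt e e' := W2 e e' /\ W1 e' e.
pose L e g := g \in G /\ W1 e g.
pose K (b : bool) kap e := arc_key Th G kap e (if b then t1 e else t2 e).
have arcs b e : e \in X -> touches e (if b then t1 e else t2 e).
  by move=> eX; case: b; [exact: to1|exact: to2].
(* L(e) grows along the order: with [g] in the second wedge at [e'], neither the angle at [e] nor
   the one at [e'] would be acute, against [dot_sum]. *)
have ltL e e' g : e \in X -> e' \in X -> lt e e' -> L e g -> W1 e' g.
  move=> eX eX' [w2 w1] [gG wg]; have [//|wg'] := coverG e' g eX' gG.
  have := wdot _ _ _ eX wg w2; have := wdot _ _ _ eX' w1 wg'.
  have := dot_sum e e' g; have := dot_gt0 (wedge_neq w2); rewrite (dotC e g); lra.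
have ltR e e' h : e \in X -> e' \in X -> lt e e' -> h \in G -> W2 e' h -> W2 e h.
  move=> eX eX' l hG wh; have [wh'|//] := coverG e h eX hG.
  by case: (wexcl e' h eX' (ltL _ _ _ eX eX' l (conj hG wh'))).
(* If both points saw each other in the first wedge, [g0] would contradict [dot_sum]; in the second
   wedge, [g] would. *)
have cmp e e' g : e \in X -> e' \in X -> e != e' -> L e g -> L e' g -> lt e e' \/ lt e' e.
  move=> eX eX' n [gG lg] [_ lg'].
  have s := dot_sum e e'; have n' : e' != e by rewrite eq_sym.
  have s0 := dot_gt0 n'.
  have [w|w] := coverX e e' eX eX' n; have [w'|w'] := coverX e' e eX' eX n'.
  - have := wdot _ _ _ eX w (W20 e eX); have := wdot _ _ _ eX' w' (W20 e' eX').
    by have := s g0; lra.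
  - by right.
  - by left.
  - have := wdot _ _ _ eX lg w; have := wdot _ _ _ eX' lg' w'.
    by have := s g; rewrite (dotC e g) (dotC e' g); lra.
have -> : (50 * #|` G| = 2 * (size (enum_fset G) + 2 * size (keys G)))%N.
  by rewrite size_keys; lia.
apply: (@chain_count R _ _ _ X (enum_fset G) (keys G) lt L K (fun e g => dot g e e)) => //.
- move=> e eX; have [g [h [T1 E]]] := to1 e eX.
  have [gG _ _ _ _] := T1; have [_ [r r0 gE]] := tight_rays T1; rewrite E in gE.
  exists g => //; split=> //; exists r, (t1 e + Th); split=> //.
  by have := le12 e eX; slra.
(* The distance to [g] grows because the angle at [e] between [g] and [e'] is not acute. *)
- move=> e e' g eX eX' l Lg; have Lg' := ltL _ _ _ eX eX' l Lg.
  split; first by split=> //; case: Lg.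
  case: l Lg => w2 w1 [gG wg].
  have := wdot _ _ _ eX wg w2; have := dot_gt0 (wedge_neq w2).
  have -> : dot g e' e' = dot g e e + dot e e' e' - 2 * dot e g e' by rewrite /dot; ring.
  lra.
- move=> b e eX; have [g [h [T1 E]]] := arcs b e eX.
  have [kap kk ak] := arc_key_exists Thge Thpi T1.
  by rewrite E in ak; exists kap.
(* Points with a common key touch the same two guards. The one on the left ray of the first cone, or
   on the right ray of the second, lies in both first wedges. *)
- move=> b kap e e' eX eX' k1 k2.
  have [g [h [t'' [d a1 a2 H]]]] := arc_key_common Thge Thpi k1 k2.
  have [|T1 _] := H (if b then t1 e else t2 e); first by rewrite ge_min le_max lexx ?orbT.
  have [|T2 _] := H t''; first by rewrite ge_min le_max lexx ?orbT.
  have [[r r0 hE] [s s0 gE]] := tight_rays T1; rewrite a1 in hE gE.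
  have [[r' r0' hE'] [s' s0' gE']] := tight_rays T2; rewrite a2 in hE' gE'.
  have [l1 l2] := le12 e eX; have [l1' l2'] := le12 e' eX'.
  have [gG hG _ _ _] := T1.
  case: (b) d hE gE => d hE gE.
    exists g; split; split=> //.
      by exists s, (t1 e + Th); split=> //; slra.
    exists s', (t1 e' + Th); split=> //; first by slra.
    by rewrite (dir_ray _ _ (dirD Th d)).
  exists h; split; split=> //.
    by exists r, (t2 e); split=> //; slra.
  exists r', (t2 e'); split=> //; first by slra.
  by rewrite (dir_ray _ _ d).
- move=> b kap e e' e'' eX eX' eX'' l l' k1 k2.
  have [g [h [t'' [d a1 a2 H]]]] := arc_key_common Thge Thpi k1 k2.
  have [|T1 _] := H (if b then t1 e else t2 e); first by rewrite ge_min le_max lexx ?orbT.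
  have [|T2 _] := H t''; first by rewrite ge_min le_max lexx ?orbT.
  have [[r r0 hE] [s s0 gE]] := tight_rays T1; rewrite a1 in hE gE.
  have [[r' r0' hE'] [s' s0' gE']] := tight_rays T2; rewrite a2 in hE' gE'.
  have [l1 l2] := le12 e eX; have [l1' l2'] := le12 e' eX'; have [l1'' l2''] := le12 e'' eX''.
  have [gG hG _ _ _] := T1.
  suff [u [hu ae du]] : exists u, [/\ Num.min (if b then t1 e else t2 e) t'' <= u <= Num.max (if b then t1 e else t2 e) t'',
      apex Th g h u = e' & same_dir u (if b then t1 e' else t2 e')].
    have [_ ak] := H u hu; rewrite ae in ak; exact: arc_key_dir du ak.
  case: (b) d hE gE T1 T2 a1 H => d hE gE T1 T2 a1 H.
    apply: (@contig R Th G Thge Thpi e (t1 e) (t2 e) e' (t1 e') (t2 e') e'' (t1 e'') (t2 e'') g h) => //.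
    + by move=> u /H[].
    + exact: bd.
    + by case: l.
    + by case: l'.
    + apply: (ltL e) => //; split=> //; exists s, (t1 e + Th); split=> //; slra.
    + apply: (ltR _ e'') => //; exists r', (t1 e'' + 2 * pi); split=> //; first by slra.
      by rewrite ray_shift (dir_ray _ _ d).
  (* For the second cone, [contig] applies with the wedges exchanged and the order reversed. *)
  rewrite minC maxC.
  have sh x : x \in X -> t1 x + 2 * pi + Th <= t2 x + 2 * pi by move=> /le12[]; lra.
  have s1 := sh e eX; have s2 := sh e' eX'; have s3 := sh e'' eX''.
  apply: (@contig R Th G Thge Thpi e'' (t2 e'') (t1 e'' + 2 * pi) e' (t2 e') (t1 e' + 2 * pi) e (t2 e) (t1 e + 2 * pi) g h) => //.
  + by move=> u; rewrite minC maxC => /H[].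
  + exact: bd.
  + by apply: wedge_shift; case: l'.
  + by case: l.
  + apply: (ltR _ e'') => //; exists s', (t2 e'' + Th); split=> //; first by slra.
    by rewrite (dir_ray _ _ (dirD Th d)).
  + by apply: wedge_shift; apply: (ltL e) => //; split=> //; exists r, (t2 e); split=> //; slra.
(* Three points common to both arcs would make their circles equal, which [circ_neq] excludes. *)
- move=> e e' e'' eX eX' eX'' n1 n2 n3 H1 H2.
  have common b : exists g h, [/\ tight Th G g h (if b then t1 e else t2 e),
      apex Th g h (if b then t1 e else t2 e) = e &
      forall q, q \in [:: e; e'; e''] -> circ Th g h q = 0].
    have [kap k1 k1'] := H1 b; have [kap2 k2 k2'] := H2 b.
    have [g [h [t [d a1 a2 H]]]] := arc_key_common Thge Thpi k1 k1'.
    have [g' [h' [t' [d' a1' a2' H']]]] := arc_key_common Thge Thpi k2 k2'.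
    have [|T1 _] := H (if b then t1 e else t2 e); first by rewrite ge_min le_max lexx ?orbT.
    have [|T2 _] := H t; first by rewrite ge_min le_max lexx ?orbT.
    have [|T1' _] := H' (if b then t1 e else t2 e); first by rewrite ge_min le_max lexx ?orbT.
    have [|T2' _] := H' t'; first by rewrite ge_min le_max lexx ?orbT.
    have [gg hh] := tight_pair_uniq T1 T1' (etrans a1 (esym a1')).
    exists g, h; split=> // q; rewrite !inE => /or3P[] /eqP ->.
    + by rewrite -[X in circ _ _ _ X]a1; exact: circ_apex.
    + by rewrite -[X in circ _ _ _ X]a2; exact: circ_apex.
    + by rewrite gg hh -[X in circ _ _ _ X]a2'; exact: circ_apex.
  have [g [h [T1 a1 C1]]] := common true; have [g' [h' [T2 a2 C2]]] := common false.
  have [l1 l2] := le12 e eX.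
  have [hr gr] := tight_rays T1; have [hr' gr'] := tight_rays T2.
  rewrite a1 in hr gr; rewrite a2 in hr' gr'.
  apply: (@circ_neq R Th Thge Thpi e (t1 e) (t2 e) g h g' h') => //.
  by apply: (circ_three Thge Thpi n1 n2 n3) => q hq; split; [exact: C1|exact: C2].
Qed.

End Crossings.

(** * The number of non-generic points outside [G] *)

Section Special.
Variables (R : realType) (Th : R) (G : {fset (R * R)}).
Hypotheses (Thge : pi / 2 <= Th) (Thpi : Th < pi).
Implicit Types (t u : R) (p q k g h x y e : R * R).
Ltac tlra := move: (@pi_gt0 R) (Thge) (Thpi) => ? ? ?; slra.
Let A := theta_region G Th.

(** [k] is the nearer of the two guards; the point is charged to it. *)
Definition two_on_ray p k t := exists h r s,
  [/\ k \in G, h \in G, 0 < r < s, k = ray p r t & h = ray p s t].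

Definition double p := exists t k, empty_cone Th G p t /\
  (two_on_ray p k t \/ two_on_ray p k (t + Th)).

Lemma ray_ray p r s t : ray p s t = ray (ray p r t) (s - r) t.
Proof. by rewrite /ray /=; congr pair; ring. Qed.

Lemma ray_back p r t : p = ray (ray p r t) (- r) t.
Proof. by rewrite {1}[p]surjective_pairing /ray /=; congr pair; ring. Qed.

Lemma ray_inj_left r t p q : ray p r t = ray q r t -> p = q.
Proof. by case: p q => ? ? [? ?] [] /addIr -> /addIr ->. Qed.

(** Moved to [k], the cone stays empty and has the farther guard on its right ray, so
    [gap_start_uniq] fixes the direction. Then [p] and [p'] lie on one line through [k]; if one were
    closer to [k], the guard on its left ray would be inside the cone of the other. *)
Lemma first_on_right p p' k j t t' : p \notin G -> p' \notin G ->
  boundary A p -> boundary A p' ->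
  empty_cone Th G p t -> empty_cone Th G p' t' -> two_on_ray p k t -> two_on_ray p' k t' ->
  quad j t -> quad j t' -> p = p'.
Proof.
move=> pG pG' bp bp' et et' D D' q q'; have sT := sinTh_gt0 Thge Thpi.
have eT a : a - (a + Th) = - Th by ring.
have ek p0 t0 : empty_cone Th G p0 t0 -> two_on_ray p0 k t0 -> empty_cone Th G k t0.
  move=> e0 [h [r [s [kG hG rs kE _]]]] x xG [x1 x2]; apply: (e0 x xG).
  rewrite (sideD t0 p0 k) (sideD (t0 + Th) p0 k) kE !side_ray -kE eT subrr sin0 mulr0 add0r sinN.
  split=> //; have : 0 < r * sin Th by rewrite mulr_gt0//; slra.
  lra.
have dd : same_dir t t'.
  have K := ek _ _ et D; have K' := ek _ _ et' D'.
  case: D D' => h [r [s [kG hG rs kE hE]]] [h' [r' [s' [_ hG' rs' kE' hE']]]].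
  apply: (@gap_start_uniq R Th G Thge Thpi k t t' h h' (s - r) (s' - r')) => //.
  - by slra.
  - by slra.
  - by rewrite hE kE -ray_ray.
  - by rewrite hE' kE' -ray_ray.
  - exact: quad_cos q q'.
have no p1 p2 r1 r2 : p1 \notin G -> boundary A p1 -> empty_cone Th G p1 t -> empty_cone Th G p2 t ->
    k = ray p1 r1 t -> k = ray p2 r2 t -> r1 < r2 -> False.
  move=> pG1 b1 e1 e2 k1 k2 r12.
  have [g [m [gG m0 gE]]] := emp_left Thge Thpi b1 pG1 e1.
  have p12 : p1 = ray p2 (r2 - r1) t.
    by rewrite (ray_back p1 r1 t) -k1 k2 /ray /=; congr pair; ring.
  apply: (e2 g gG); rewrite (sideD t p2 p1) (sideD (t + Th) p2 p1) gE.
  rewrite {1 4}p12 !side_ray eT !subrr sin0 !mulr0 add0r addr0 sinN.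
  have -> : t + Th - t = Th by ring.
  have : 0 < (r2 - r1) * sin Th by rewrite mulr_gt0// subr_gt0.
  by have := mulr_gt0 m0 sT; split; lra.
have et2 := emp_dir (dir_sym dd) et'.
case: D D' => h [r [s [kG hG rs kE hE]]] [h' [r' [s' [_ hG' rs' kE' hE']]]].
rewrite -(dir_ray p' r' dd) in kE'.
have [rr|rr|rr] := ltgtP r r'.
- by case: (no p p' r r').
- by case: (no p' p r' r).
- by apply: (@ray_inj_left r t); rewrite -kE kE' rr.
Qed.

Lemma first_on_left p p' k j t t' : p \notin G -> p' \notin G ->
  boundary A p -> boundary A p' ->
  empty_cone Th G p t -> empty_cone Th G p' t' -> two_on_ray p k (t + Th) -> two_on_ray p' k (t' + Th) ->
  quad j (t + Th) -> quad j (t' + Th) -> p = p'.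
Proof.
move=> pG pG' bp bp' et et' D D' q q'; have sT := sinTh_gt0 Thge Thpi.
have eT a : a + Th - a = Th by ring.
have ek p0 t0 : empty_cone Th G p0 t0 -> two_on_ray p0 k (t0 + Th) -> empty_cone Th G k t0.
  move=> e0 [h [r [s [kG hG rs kE _]]]] x xG [x1 x2]; apply: (e0 x xG).
  rewrite (sideD t0 p0 k) (sideD (t0 + Th) p0 k) kE !side_ray -kE eT subrr sin0 mulr0 add0r.
  split=> //; have : 0 < r * sin Th by rewrite mulr_gt0//; slra.
  lra.
have dd : same_dir t t'.
  have K := ek _ _ et D; have K' := ek _ _ et' D'.
  case: D D' => h [r [s [kG hG rs kE hE]]] [h' [r' [s' [_ hG' rs' kE' hE']]]].
  apply: (@gap_end_uniq R Th G Thge Thpi k t t' h h' (s - r) (s' - r')) => //.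
  - by slra.
  - by slra.
  - by rewrite hE kE -ray_ray.
  - by rewrite hE' kE' -ray_ray.
  - by have := quad_cos q q'; have -> : t' + Th - (t + Th) = t' - t by ring.
have no p1 p2 r1 r2 : p1 \notin G -> boundary A p1 -> empty_cone Th G p1 t -> empty_cone Th G p2 t ->
    k = ray p1 r1 (t + Th) -> k = ray p2 r2 (t + Th) -> r1 < r2 -> False.
  move=> pG1 b1 e1 e2 k1 k2 r12.
  have [g [m [gG m0 gE]]] := emp_right Thge Thpi b1 pG1 e1.
  have p12 : p1 = ray p2 (r2 - r1) (t + Th).
    by rewrite (ray_back p1 r1 (t + Th)) -k1 k2 /ray /=; congr pair; ring.
  apply: (e2 g gG); rewrite (sideD t p2 p1) (sideD (t + Th) p2 p1) gE.
  rewrite {1 4}p12 !side_ray eT !subrr sin0 !mulr0 add0r addr0.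
  have -> : t - (t + Th) = - Th by ring.
  rewrite sinN; have : 0 < (r2 - r1) * sin Th by rewrite mulr_gt0// subr_gt0.
  by have := mulr_gt0 m0 sT; split; lra.
have et2 := emp_dir (dir_sym dd) et'.
case: D D' => h [r [s [kG hG rs kE hE]]] [h' [r' [s' [_ hG' rs' kE' hE']]]].
rewrite -(dir_ray p' r' (dirD Th dd)) in kE'.
have [rr|rr|rr] := ltgtP r r'.
- by case: (no p p' r r').
- by case: (no p' p r' r).
- by apply: (@ray_inj_left r (t + Th)); rewrite -kE kE' rr.
Qed.

Lemma size_double (Y : seq (R * R)) : uniq Y ->
  (forall p, p \in Y -> [/\ boundary A p, p \notin G & double p]) ->
  (size Y <= 8 * #|` G|)%N.
Proof.
move=> uY HY.
(* A bounding ray, the nearer guard and a quadrant: [2 * 4] choices per guard. *)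
pose D := allpairs pair (allpairs pair [:: true; false] (enum_fset G)) (iota 0 4).
have -> : (8 * #|` G| = size D)%N by rewrite /D !size_allpairs size_iota /=; lia.
pose Q p (x : bool * (R * R) * nat) := [/\ boundary A p, p \notin G & exists t, empty_cone Th G p t /\
  let a := if x.1.1 then t else t + Th in two_on_ray p x.1.2 a /\ quad x.2 a].
apply: (@size_rel_in _ _ Q) => //.
  move=> p /HY[bp pG [t [k [et D']]]].
  have [b Db] : exists b : bool, two_on_ray p k (if b then t else t + Th).
    by case: D' => ?; [exists true|exists false].
  have [j j4 qj] := quad_exists (if b then t else t + Th).
  have kG : k \in G by case: Db => ? [? [? []]].
  exists (b, k, j).
    apply/allpairsP; exists ((b, k), j); split=> //; apply/allpairsP; exists (b, k).
    by split=> //; case: (b).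
  by split=> //; exists t.
move=> p p' [[[] k] j] pY pY' [bp pG [t [et [d q]]]] [bp' pG' [t' [et' [d' q']]]].
  exact: (first_on_right pG pG' bp bp' et et' d d' q q').
exact: (first_on_left pG pG' bp bp' et et' d d' q q').
Qed.

Lemma not_double_touches p t : boundary A p -> p \notin G -> ~ double p ->
  empty_cone Th G p t -> touches Th G p t.
Proof.
move=> bp pG nd et.
have [h [r [hG r0 hE]]] := emp_right Thge Thpi bp pG et.
have [g [s [gG s0 gE]]] := emp_left Thge Thpi bp pG et.
have uniq a k l (x y : R) : (forall k, ~ two_on_ray p k a) -> k \in G -> l \in G -> 0 < x -> 0 < y ->
    k = ray p x a -> l = ray p y a -> k = l.
  move=> N kG lG x0 y0 kE lE; have [xy|yx|xy] := ltgtP x y.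
  - by case: (N k); exists l, x, y; rewrite x0.
  - by case: (N l); exists k, y, x; rewrite y0.
  - by rewrite kE lE xy.
exists g, h; apply: (tight_unique Thge Thpi) => //.
- by exists r.
- by exists s.
- move=> k x kG x0 kE; apply: (uniq t k h x r) => // k' tw; apply: nd.
  by exists t, k'; split=> //; left.
- move=> k x kG x0 kE; apply: (uniq (t + Th) k g x s) => // k' tw; apply: nd.
  by exists t, k'; split=> //; right.
Qed.

(** The guard on the right ray of one cone is not inside the other, so the two cones do not overlap.
    Starting from the other cone if necessary puts [g0] in the second wedge. *)
Lemma crossing_exists g0 p t u : g0 \in G -> boundary A p -> touches Th G p t ->
  touches Th G p u -> ~ same_dir t u -> exists t1 t2, crossing Th G g0 p t1 t2.
Proof.
move=> g0G bp Tt Tu nd.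
have [v hv dv] := dir_norm t u.
have Tv := touches_dir (dir_sym dv) Tu.
have nt : v != t by apply: contra_notN nd => /eqP <-.
have nt2 : v != t + 2 * pi.
  apply: contra_notN nd => /eqP E; apply: dir_trans dv; rewrite E.
  exact/dir_sym/dir_2pi.
have incone a b : a < b -> b < a + Th -> touches Th G p a -> touches Th G p b -> False.
  move=> ab ba Ta [g [h [T E]]]; have [[r r0 hE] _] := tight_rays Thge Thpi T.
  have [_ hG _ _ _] := T; rewrite E in hE.
  apply: (touches_emp Thge Thpi Ta hG); rewrite hE !side_ray; split.
    by apply: mulr_gt0 => //; apply: sin_gt0_pi; tlra.
  rewrite pmulr_rlt0// -oppr_gt0 -sinN; apply: sin_gt0_pi; tlra.
have tv : t < v by rewrite lt_neqAle eq_sym nt; slra.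
have vt : v < t + 2 * pi by rewrite lt_neqAle nt2; slra.
have T2 : touches Th G p (t + 2 * pi) by apply: touches_dir Tt; exact/dir_sym/dir_2pi.
have l1 : t + Th <= v by rewrite leNgt; apply/negP => l; exact: (incone t v).
have l2 : v + Th <= t + 2 * pi by rewrite leNgt; apply/negP => l; exact: (incone v (t + 2 * pi)).
have pg : g0 != p by apply: contraTneq g0G => ->; exact: touches_notin Tt.
have [w|w] := wedge_cover Thge Thpi l1 l2 pg (touches_emp Thge Thpi Tt g0G) (touches_emp Thge Thpi Tv g0G).
  exists v, (t + 2 * pi); split=> //; last exact: wedge_shift.
  by split=> //; lra.
by exists t, v; split.
Qed.

Definition generic p := [/\ boundary A p, p \notin G, ~ double p &
  forall t u, empty_cone Th G p t -> empty_cone Th G p u -> same_dir t u].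

(** Per guard, [8] accounts for points with two guards on one ray and [50] for points with two empty
    cones. *)
Lemma size_special g0 (Z : seq (R * R)) : g0 \in G -> uniq Z ->
  (forall p, p \in Z -> [/\ boundary A p, p \notin G & ~ generic p]) ->
  (size Z <= 58 * #|` G|)%N.
Proof.
move=> g0G uZ HZ.
pose d p := `[< double p >].
have -> : size Z = (size (seq.filter d Z) + size (seq.filter (predC d) Z))%N.
  by rewrite !size_filter count_predC.
have -> : (58 * #|` G| = 8 * #|` G| + 50 * #|` G|)%N by lia.
apply: leq_add.
  apply: size_double; first by rewrite filter_uniq.
  by move=> p; rewrite mem_filter => /andP[/asboolP dp /HZ[]].
apply: (size_crossings Thge Thpi g0G); first by rewrite filter_uniq.
move=> p; rewrite mem_filter => /andP[/asboolP dp /HZ[bp pG ng]].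
have [t [u [et eu nd]]] : exists t u, [/\ empty_cone Th G p t, empty_cone Th G p u & ~ same_dir t u].
  apply: contrapT => N; apply: ng; split=> // t u et eu.
  by apply: contrapT => nd; apply: N; exists t, u.
by apply: (crossing_exists g0G bp _ _ nd); exact: not_double_touches.
Qed.

End Special.

(** * The boundary near a generic point *)

Section Local.
Variables (R : realType) (Th : R) (G : {fset (R * R)}).
Hypotheses (Thge : pi / 2 <= Th) (Thpi : Th < pi).
Implicit Types (t u : R) (p q k g h x y e c : R * R).
Ltac tlra := move: (@pi_gt0 R) (Thge) (Thpi) => ? ? ?; slra.
Let A := theta_region G Th.

Lemma crs_cont h k : continuous (fun q => cross q h k).
Proof.
move=> q; rewrite /cross.
by apply: cvgB; apply: cvgM; apply: cvgB; (exact: cvg_cst || exact: cvg_fst || exact: cvg_snd).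
Qed.

Lemma dot_cont h k : continuous (fun q => dot q h k).
Proof.
move=> q; rewrite /dot.
by apply: cvgD; apply: cvgM; apply: cvgB; (exact: cvg_cst || exact: cvg_fst || exact: cvg_snd).
Qed.

Lemma circ_cont g h : continuous (fun q => circ Th g h q).
Proof.
move=> q; rewrite /circ.
by apply: cvgB; apply: cvgM; [exact: cvg_cst|exact: crs_cont|exact: cvg_cst|exact: dot_cont].
Qed.

Lemma crs_side h q k r w : h = ray q r w -> cross q h k = r * side w q k.
Proof. by move=> ->; rewrite /cross /side /ray /=; ring. Qed.

Lemma circ_side h q k r w : h = ray q r w -> circ Th k h q = r * side (w + Th) q k.
Proof. by move=> ->; rewrite /circ /cross /dot /side /ray /= cosD sinD; ring. Qed.

(** Relative to [u], the direction of [h] is in [(Th - pi, 0]] and that of [g] in [[Th, pi)]. Their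
    difference minus [Th] is in [[0, 2 * pi - 2 * Th)], where the sine is non-negative since
    [Th >= pi / 2]. *)
Lemma circ_ge0 g h q u : g != q -> h != q -> side u q h <= 0 -> 0 <= side (u + Th) q g ->
  side (u + Th) q h < 0 -> 0 < side u q g -> 0 <= circ Th g h q.
Proof.
move=> gq hq.
have [r [a [r0 ha ->]]] := polar (u - pi) hq.
have [s [b [s0 hb ->]]] := polar u gq.
rewrite circ_ray !side_ray pmulr_rle0// pmulr_rge0// pmulr_rlt0// pmulr_rgt0//.
move=> s1 s2 s3 s4; rewrite pmulr_rge0 ?mulr_gt0//.
have B1 := @sin_gt0_ltpi R (b - u).
have B2 := @sin_gt0_pi R (u + Th - b).
have e2 : sin (u + Th - b) = - sin (b - (u + Th)) by rewrite -sinN opprB.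
have b1 : b - u < pi by slra.
have b2 : Th <= b - u by rewrite leNgt; apply/negP => l; tlra.
have A1 := @sin_gt0_pi R (a - u).
have A2 := @sin_ge0_pi R (a - (u + Th) + 2 * pi).
rewrite sin2pi_shift in A2.
have sT := sinTh_gt0 Thge Thpi.
have api : a - u < pi.
  rewrite lt_neqAle; apply/andP; split; last by slra.
  apply/eqP => E; have E2 : a - (u + Th) = pi - Th by lra.
  by rewrite E2 sinB sinpi cospi in s3; lra.
have a1 : a - u <= 0 by rewrite leNgt; apply/negP => l; slra.
have a2 : Th - pi < a - u by rewrite ltNge; apply/negP => l; tlra.
by apply: sin_ge0_pi; tlra.
Qed.

Lemma circ_circle g h : g != h -> exists c r, 0 < r /\
  forall q, circ Th g h q = sin Th * (r ^+ 2 - ((q.1 - c.1) ^+ 2 + (q.2 - c.2) ^+ 2)).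
Proof.
move=> gh; have sT := sinTh_gt0 Thge Thpi.
have sn : sin Th != 0 by rewrite gt_eqF.
(* The centre, where the gradient of [circ Th g h] vanishes. *)
pose c := ((h.1 + g.1) / 2 + cos Th / (2 * sin Th) * (h.2 - g.2),
           (h.2 + g.2) / 2 + cos Th / (2 * sin Th) * (g.1 - h.1)).
have E q : circ Th g h q = circ Th g h c - sin Th * ((q.1 - c.1) ^+ 2 + (q.2 - c.2) ^+ 2).
  rewrite (circ_expand _ g h c q).
  have -> : cos Th * (h.2 - g.2) + sin Th * (h.1 + g.1 - 2 * c.1) = 0.
    by rewrite /c /=; field.
  have -> : cos Th * (g.1 - h.1) + sin Th * (h.2 + g.2 - 2 * c.2) = 0.
    by rewrite /c /=; field.
  by ring.
have cg : circ Th g h g = 0 by rewrite /circ /cross /dot; ring.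
have ch : circ Th g h h = 0 by rewrite /circ /cross /dot; ring.
have Eg := E g; have Eh := E h; rewrite cg in Eg; rewrite ch in Eh.
(* [circ] vanishes at [g] and [h], at least one of which is not the centre. *)
have c0 : 0 < circ Th g h c.
  have [gc|gc] := eqVneq g c.
    have hc : h != c by rewrite -gc eq_sym.
    by have := mulr_gt0 sT (neq_sqr_gt0 hc); lra.
  by have := mulr_gt0 sT (neq_sqr_gt0 gc); lra.
exists c, (Num.sqrt (circ Th g h c / sin Th)); split.
  by rewrite sqrtr_gt0 divr_gt0.
move=> q; rewrite sqr_sqrtr ?divr_ge0 ?ltW//.
by rewrite (E q); field.
Qed.

Section Point.
Variables (p g h : R * R) (t : R).
Hypotheses (Gp : generic Th G p) (T : tight Th G g h t) (aE : apex Th g h t = p).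

(** All empty cones at [p] have direction [t], so by [near_dirs] those at nearby points have nearby
    directions. Then [g] and [h] stay strictly inside one half-plane each, and emptiness keeps them
    out of the other. *)
Lemma near_emp_sides : \forall q \near p, forall u, empty_cone Th G q u ->
  [/\ side u q h <= 0, 0 <= side (u + Th) q g, side (u + Th) q h < 0 & 0 < side u q g].
Proof.
have [gG hG s1 s2 _] := T.
apply: (@near_dirs R (fun q u => empty_cone Th G q u ->
  [/\ side u q h <= 0, 0 <= side (u + Th) q g, side (u + Th) q h < 0 & 0 < side u q g])).
  move=> u; have [eu|neu] := pselect (empty_cone Th G p u); last first.
    by apply: filterS (near_not_emp neu) => z ne /ne.
  have et : empty_cone Th G p t by rewrite -aE; exact: tight_emp.
  have d : same_dir t u by case: Gp => _ _ _; apply.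
  have s3 : 0 < side u p g by rewrite -(dir_side _ _ d) -aE apex_r.
  have s4 : side (u + Th) p h < 0 by rewrite -(dir_side _ _ (dirD Th d)) -aE apex_l.
  have n1 := near_gt0 (@side_cont R g (p, u)) s3.
  have n2 := near_lt0 (@side_contD R Th h (p, u)) s4.
  apply: filterS2 n1 n2 => z z1 z2 ez; split=> //.
    by rewrite leNgt; apply/negP => z3; apply: (ez h hG).
  by rewrite leNgt; apply/negP => z3; apply: (ez g gG).
move=> q u v d H /(emp_dir (dir_sym d))/H.
by rewrite !(dir_side _ _ d) !(dir_side _ _ (dirD Th d)).
Qed.

Lemma near_neq k : k != p -> \forall q \near p, k != q.
Proof.
move=> kp; have c : {for p, continuous (fun q => dot k q q)}.
  rewrite /dot; apply: cvgD; apply: cvgM; apply: cvgB; (exact: cvg_cst || exact: cvg_fst || exact: cvg_snd).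
rewrite eq_sym in kp.
apply: filterS (near_gt0 c (dot_gt0 kp)) => q; apply: contraTneq => ->.
by rewrite /dot !subrr mulr0 addr0 ltxx.
Qed.

(** Near [p] only the pair matters: an empty cone gives [0 <= circ] by [circ_ge0], and conversely
    the cone whose right ray passes through [h] is empty. *)
Lemma near_unguarded : \forall q \near p, ~ A q <-> 0 <= circ Th g h q.
Proof.
have [gG hG s1 s2 H] := T.
have [hr gr] := tight_rays Thge Thpi T; rewrite aE in hr gr.
have pG : p \notin G by rewrite -aE; exact: tight_apex_notin T.
have kp k : k \in G -> k != p by move=> kG; apply: contraNneq pG => <-.
have n1 := near_emp_sides.
have n2 := near_neq (kp g gG); have n3 := near_neq (kp h hG).
have n4 : \forall q \near p, forall k, k \in G -> (k != g -> k != h -> cross q h k < 0 \/ 0 < circ Th k h q).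
  apply: (@near_fset _ _ (nbhs p) _ (fun k q => k != g -> k != h -> cross q h k < 0 \/ 0 < circ Th k h q)) => k kG.
  have [kg|kg] := eqVneq k g; first by apply: nearW.
  have [kh|kh] := eqVneq k h; first by apply: nearW.
  have [r r0 hE] := hr.
  have e1 : cross p h k = r * side t h k by rewrite (crs_side k hE) -aE apex_r.
  have e2 : circ Th k h p = r * side (t + Th) g k.
    by rewrite (circ_side k hE) -{1}aE apex_l.
  case: (H k kG kg kh) => s.
    have c0 : cross p h k < 0 by rewrite e1 pmulr_rlt0.
    by apply: filterS (near_lt0 (@crs_cont h k p) c0) => q; left.
  have c0 : 0 < circ Th k h p by rewrite e2 mulr_gt0.
  by apply: filterS (near_gt0 (@circ_cont k h p) c0) => q; right.
near=> q; split.
  move=> /(regionNP G Thge Thpi)[u eu].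
  have [z1 z2 z3 z4] : [/\ side u q h <= 0, 0 <= side (u + Th) q g, side (u + Th) q h < 0 & 0 < side u q g].
    by move: u eu; near: q.
  by apply: circ_ge0 z1 z2 z3 z4; near: q.
move=> C0; apply/(regionNP G Thge Thpi).
have hq : h != q by near: q.
have [r [w [r0 _ hE]]] := polar 0 hq.
exists w => k kG [k1 k2].
have [kh|kh] := eqVneq k h.
  by move: k1; rewrite kh hE side_ray subrr sin0 mulr0 ltxx.
have [kg|kg] := eqVneq k g.
  move: C0; rewrite (circ_side g hE) pmulr_rge0// -kg; lra.
have : cross q h k < 0 \/ 0 < circ Th k h q by move: k kG kg kh {k1 k2}; near: q.
by rewrite (crs_side k hE) (circ_side k hE) pmulr_rlt0// pmulr_rgt0//; case; lra.
Unshelve. all: by end_near. Qed.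

Lemma tight_neq : g != h.
Proof. by case: T => _ _ s _ _; apply: contraTneq s => ->; rewrite side_id ltxx. Qed.

(** Where [circ] is positive a whole neighbourhood is unguarded; points of the circle become guarded
    when pushed outward. *)
Lemma near_boundary : \forall q \near p, boundary A q <-> circ Th g h q = 0.
Proof.
have sT := sinTh_gt0 Thge Thpi.
have [c [r [r0 CE]]] := circ_circle tight_neq.
(* The equivalence is needed on a neighbourhood of [q], not only at [q]. *)
have := near_join near_unguarded; apply: filterS => q nq.
have nqq : ~ A q <-> 0 <= circ Th g h q := nbhs_singleton nq.
apply: (iff_trans (boundaryE G Thge Thpi q)); split.
  move=> [cA /nqq C0]; apply/eqP; rewrite eq_le C0 andbT leNgt; apply/negP => C1.
  have n2 := near_gt0 (@circ_cont g h q) C1.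
  have [x [Ax [h1 h2]]] := cA _ (filterI nq n2).
  by apply: (iffRL h1); first exact: ltW.
move=> C0; split; last by apply/nqq; rewrite C0.
move=> B nB.
pose f (e : R) := (q.1 + e * (q.1 - c.1), q.2 + e * (q.2 - c.2)).
have cf : f e @[e --> 0] --> q.
  suff: f e @[e --> 0] --> (q.1, q.2) by rewrite -surjective_pairing.
  rewrite /f.
  have fx (x y : R) : x + e * y @[e --> 0] --> x.
    rewrite -[X in _ --> X]addr0 -[X in _ --> x + X](mul0r y).
    by apply: cvgD; [exact: cvg_cst|apply: cvgM; [exact: cvg_id|exact: cvg_cst]].
  by apply: (@cvg_pair _ _ _ _ (nbhs (q.1 : R)) (nbhs (q.2 : R))); exact: fx.
have nn : \forall e \near (0 : R)^'+, [/\ 0 < e, B (f e) & ~ A (f e) <-> 0 <= circ Th g h (f e)].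
  near=> e; split; near: e.
  - exact: nbhs_right_gt.
  - by apply: cvg_within; exact: (cf _ nB).
  - by apply: cvg_within; exact: (cf _ nq).
have [e [e0 Be he]] := filter_ex nn.
exists (f e); split=> //; apply: contrapT => /he.
rewrite CE /f /=.
have dE : (q.1 - c.1) ^+ 2 + (q.2 - c.2) ^+ 2 = r ^+ 2.
  move: C0; rewrite CE => /eqP; rewrite mulf_eq0 gt_eqF//= subr_eq0 => /eqP ->.
  by [].
have -> : (q.1 + e * (q.1 - c.1) - c.1) ^+ 2 + (q.2 + e * (q.2 - c.2) - c.2) ^+ 2
  = (1 + e) ^+ 2 * ((q.1 - c.1) ^+ 2 + (q.2 - c.2) ^+ 2) by ring.
rewrite dE pmulr_rge0//.
have r20 : 0 < r ^+ 2 by rewrite exprn_gt0.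
have : 0 < (2 * e + e ^+ 2) * r ^+ 2 by rewrite mulr_gt0// addr_gt0 ?mulr_gt0 ?exprn_gt0.
lra.
Unshelve. all: by end_near. Qed.

Lemma generic_arc_point : arc_point A p.
Proof.
split; first by case: Gp.
have [c [r [r0 CE]]] := circ_circle tight_neq.
have sT := sinTh_gt0 Thge Thpi.
exists c, r; split=> //; apply: filterS near_boundary => q ->.
rewrite CE /circle /=; split.
  by move=> /eqP; rewrite mulf_eq0 gt_eqF//= subr_eq0 => /eqP ->.
by move=> ->; rewrite subrr mulr0.
Qed.

Lemma tight_not_two u k : tight Th G g h u ->
  ~ two_on_ray G (apex Th g h u) k u /\ ~ two_on_ray G (apex Th g h u) k (u + Th).
Proof.
move=> Tu; have sT := sinTh_gt0 Thge Thpi.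
have [gG hG s1 s2 H] := Tu.
have onr x s : x \in G -> 0 < s -> x = ray (apex Th g h u) s u -> x = h.
  move=> xG s0 xE; apply/eqP; apply: contrapT => /negP xh.
  have x1 : side u h x = 0 by rewrite -(apex_r Th g) xE side_ray subrr sin0 mulr0.
  have x2 : side (u + Th) g x < 0.
    rewrite -(apex_l Thge Thpi g h) xE side_ray.
    have -> : u - (u + Th) = - Th by ring.
    by rewrite sinN mulrN oppr_lt0 mulr_gt0.
  have xg : x != g by apply: contraTneq x2 => ->; rewrite side_id ltxx.
  by case: (H x xG xg xh); lra.
have onl x s : x \in G -> 0 < s -> x = ray (apex Th g h u) s (u + Th) -> x = g.
  move=> xG s0 xE; apply/eqP; apply: contrapT => /negP xg.
  have x1 : side (u + Th) g x = 0.
    by rewrite -(apex_l Thge Thpi g h) xE side_ray subrr sin0 mulr0.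
  have x2 : 0 < side u h x.
    rewrite -(apex_r Th g) xE side_ray.
    have -> : u + Th - u = Th by ring.
    by rewrite mulr_gt0.
  have xh : x != h by apply: contraTneq x2 => ->; rewrite side_id ltxx.
  by case: (H x xG xg xh); lra.
have fin a x y (r s : R) : 0 < r < s -> x = ray (apex Th g h u) r a -> y = ray (apex Th g h u) s a -> x <> y.
  move=> rs xE yE E; have [] : r = s /\ same_dir a a.
    by apply: (@ray_inj_dir _ (apex Th g h u)); rewrite -?xE -?yE//; slra.
  by move=> rsE; move: rs; rewrite rsE ltxx andbF.
split=> -[x [r [s [kG xG rs kE xE]]]]; apply: (fin _ _ _ _ _ rs kE xE).
  have r0 : 0 < r by case/andP: rs.
  have s0 : 0 < s by case/andP: rs => ?; exact: lt_trans.
  by rewrite (onr k r kG r0 kE) (onr x s xG s0 xE).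
have r0 : 0 < r by case/andP: rs.
have s0 : 0 < s by case/andP: rs => ?; exact: lt_trans.
by rewrite (onl k r kG r0 kE) (onl x s xG s0 xE).
Qed.

Lemma generic_near : \forall u \near t, tight Th G g h u /\ generic Th G (apex Th g h u).
Proof.
have sT := sinTh_gt0 Thge Thpi.
have ca : apex Th g h u @[u --> t] --> p by rewrite -aE; exact: apex_cont.
have n1 := tight_near T.
have n2 := ca _ near_boundary.
have n3 := ca _ near_emp_sides.
apply: filterS3 n1 n2 n3 => u Tu bu eu; split=> //.
have C0 := circ_apex Thge Thpi Tu.
have [[r r0 hE] [s s0 gE]] := tight_rays Thge Thpi Tu.
(* At this apex [h] and [g] lie on the rays of directions [u] and [u + Th], so the two weak
   inequalities of [eu] force [sin (u - v) = 0]. *)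
have dirs v : empty_cone Th G (apex Th g h u) v -> same_dir v u.
  move=> /eu[z1 z2 z3 _].
  have e1 : side v (apex Th g h u) h = r * sin (u - v).
    by have := side_ray v (apex Th g h u) r u; rewrite -hE.
  rewrite e1 pmulr_rle0// in z1.
  have e2 : side (v + Th) (apex Th g h u) g = s * sin (u - v).
    have -> : u - v = u + Th - (v + Th) by ring.
    by have := side_ray (v + Th) (apex Th g h u) s (u + Th); rewrite -gE.
  rewrite e2 pmulr_rge0// in z2.
  have e3 : side (v + Th) (apex Th g h u) h = r * sin ((u - v) - Th).
    have -> : u - v - Th = u - (v + Th) by ring.
    by have := side_ray (v + Th) (apex Th g h u) r u; rewrite -hE.
  rewrite e3 pmulr_rlt0// sinB in z3.
  have s0' : sin (u - v) = 0 by apply/eqP; rewrite eq_le z1 z2.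
  apply: dir_of_sin0 => //; rewrite s0' mul0r sub0r oppr_lt0 in z3.
  by rewrite pmulr_lgt0 in z3.
split.
- by apply/bu.
- exact: tight_apex_notin Tu.
- move=> [v [k [ev D]]]; have d := dirs v ev.
  have [N1 N2] := tight_not_two k Tu.
  case: D => -[x [a [b [kG xG ab kE xE]]]]; [apply: N1|apply: N2]; exists x, a, b; split=> //.
  + by rewrite -(dir_ray _ _ d).
  + by rewrite -(dir_ray _ _ d).
  + by rewrite -(dir_ray _ _ (dirD Th d)).
  + by rewrite -(dir_ray _ _ (dirD Th d)).
- by move=> v w ev ew; apply: dir_trans (dirs v ev) (dir_sym (dirs w ew)).
Qed.

End Point.
End Local.

(** The bound on lists also gives finiteness, as an infinite set contains arbitrarily long
    duplicate-free lists. *)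
Lemma counting_le (R : realType) (T : choiceType) (S : set T) (m : nat) :
  (forall s : seq T, uniq s -> (forall x, x \in s -> S x) -> (size s <= m)%N) ->
  (counting S <= m%:R%:E :> \bar R)%E.
Proof.
move=> H; have finS : finite_set S.
  apply: contrapT => /(@infinite_set_fset _ _ m.+1)[B BS mB].
  have := H (enum_fset B) (fset_uniq B) (fun x xB => BS x xB).
  by rewrite leqNgt mB.
rewrite /counting asboolT// lee_fin ler_nat; apply: H; first exact: fset_uniq.
by move=> x; rewrite in_fset_set// inE.
Qed.

(** * Counting vertices and edges *)

Section Edges.
Variables (R : realType) (Th : R) (G : {fset (R * R)}).
Hypotheses (Thge : pi / 2 <= Th) (Thpi : Th < pi).
Implicit Types (t u : R) (p q k g h x y e c : R * R).
Ltac tlra := move: (@pi_gt0 R) (Thge) (Thpi) => ? ? ?; slra.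
Let A := theta_region G Th.
Let S := [set q | arc_point A q].

Lemma generic_tight p : generic Th G p ->
  exists g h t, tight Th G g h t /\ apex Th g h t = p.
Proof.
move=> Gp; have [bp pG nd _] := Gp.
have [t et] := boundary_emp Thge Thpi bp.
have [g [h [T aE]]] := not_double_touches Thge Thpi bp pG nd et.
by exists g, h, t.
Qed.

Lemma generic_arc p : generic Th G p -> arc_point A p.
Proof.
by move=> Gp; have [g [h [t [T aE]]]] := generic_tight Gp; exact: (generic_arc_point Thge Thpi Gp T aE).
Qed.

(** The guards themselves add [1] per guard to the [58] of [size_special]. *)
Lemma size_nongeneric g0 (s : seq (R * R)) : g0 \in G -> uniq s ->
  (forall p, p \in s -> boundary A p /\ ~ generic Th G p) -> (size s <= 59 * #|` G|)%N.
Proof.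
move=> g0G us Hs.
have -> : size s = (size (seq.filter (mem G) s) + size (seq.filter (predC (mem G)) s))%N.
  by rewrite !size_filter count_predC.
have -> : (59 * #|` G| = #|` G| + 58 * #|` G|)%N by lia.
apply: leq_add.
  apply: uniq_leq_size; first by rewrite filter_uniq.
  by move=> p; rewrite mem_filter => /andP[].
apply: (size_special Thge Thpi g0G); first by rewrite filter_uniq.
by move=> p; rewrite mem_filter => /andP[/= pG /Hs[]].
Qed.

Lemma size_vertices g0 (s : seq (R * R)) : g0 \in G -> uniq s ->
  (forall p, p \in s -> vertices A p) -> (size s <= 59 * #|` G|)%N.
Proof.
move=> g0G us Hs; apply: (size_nongeneric g0G us) => p /Hs[bp na]; split=> //.
by move=> /generic_arc.
Qed.

Lemma path_in_component (f : R -> R * R) a b : a <= b -> continuous f ->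
  (forall u, a <= u <= b -> S (f u)) -> connected_component S (f a) (f b).
Proof.
move=> ab cf H.
apply: (@connected_component_max _ S (f @` `[a, b]%classic) (f a)).
- by exists a => //=; rewrite in_itv/= lexx.
- by move=> _ [u /= + <-]; rewrite in_itv/=; exact: H.
- apply: connected_continuous_connected; first exact: segment_connected.
  by apply: continuous_subspaceT => ?; exact: cf.
- by exists b => //=; rewrite in_itv/= lexx ab.
Qed.

Lemma dir_close (a b : R) : `|a - b| < 2 * pi -> same_dir a b -> a = b.
Proof.
move=> ab d; apply/eqP; rewrite -subr_eq0 -normr_eq0; apply/negP => /negP n.
have c1 : cos `|a - b| = 1.
  by rewrite cos_norm cosB d.1 d.2 -!expr2 cos2Dsin2.
have n0 : 0 < `|a - b| by rewrite lt_neqAle eq_sym n normr_ge0.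
by have := @cos_eq1_2pi R `|a - b|; rewrite c1 n0 (ltW ab) => /(_ erefl erefl); lra.
Qed.

(** The component contains a piece of a circle, hence more points than the finite number of
    non-generic ones. *)
Lemma component_generic g0 p : g0 \in G -> arc_point A p ->
  exists2 q, connected_component S p q & generic Th G q.
Proof.
move=> g0G [bp [c [r [r0 near_c]]]].
have cp : circle c r p by apply/(nbhs_singleton near_c).
have pc : p != c.
  apply/eqP => pc; move: cp; rewrite /circle /= pc !subrr expr0n/= addr0 => /eqP.
  by rewrite eq_sym expf_eq0/= gt_eqF.
have [r' [t0 [r'0 _ pE]]] := polar 0 pc.
have rr : r' = r.
  apply/eqP; rewrite -(eqrXn2 (n := 2))// ?ltW//; apply/eqP.
  move: cp; rewrite /circle /= pE /ray /= => <-.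
  rewrite -[LHS]mulr1 -(cos2Dsin2 t0); ring.
rewrite rr {r' r'0 rr} in pE.
pose f (s : R) := ray c r (t0 + s).
have f0 : f 0 = p by rewrite /f addr0 -pE.
have cf : continuous f.
  move=> s; apply: (@cvg_pair _ _ _ _ (nbhs (c.1 + r * cos (t0 + s))) (nbhs (c.2 + r * sin (t0 + s)))).
    apply: cvgD; [exact: cvg_cst|apply: cvgM; first exact: cvg_cst].
    by apply: continuous_comp; [apply: cvgD; [exact: cvg_cst|exact: cvg_id]|exact: continuous_cos].
  apply: cvgD; [exact: cvg_cst|apply: cvgM; first exact: cvg_cst].
  by apply: continuous_comp; [apply: cvgD; [exact: cvg_cst|exact: cvg_id]|exact: continuous_sin].
have fc s : circle c r (f s).
  rewrite /circle /f /ray /=; rewrite -[RHS]mulr1 -(cos2Dsin2 (t0 + s)); ring.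
have nf : \forall s \near (0 : R), \forall q \near f s, boundary A q <-> circle c r q.
  have nj : \forall x \near f 0, \forall q \near x, boundary A q <-> circle c r q.
    by rewrite f0; exact: near_join near_c.
  exact: (cf 0 _ nj).
have [d /= d0 hd] := nf.
(* A parameter range of length at most 1, below a full turn, keeps the sample points distinct. *)
pose dl := Num.min (d / 2) 1.
have dl0 : 0 < dl by rewrite lt_min divr_gt0//= ltr01.
have dld : dl < d by rewrite gt_min; apply/orP; left; lra.
have dl1 : dl <= 1 by rewrite ge_min lexx orbT.
clearbody dl.
have small (x y : R) : 0 <= x <= dl -> 0 <= y <= dl -> `|x - y| < 2 * pi.
  by move=> hx hy; have := @pi_ge2 R; rewrite ltr_norml => ?; slra.
have good s : 0 <= s <= dl -> S (f s).
  move=> hs; have hn : \forall q \near f s, boundary A q <-> circle c r q.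
    by apply: hd => /=; rewrite sub0r normrN ger0_norm; slra.
  by split; [apply/(nbhs_singleton hn); exact: fc|exists c, r].
have comp s : 0 <= s <= dl -> connected_component S p (f s).
  move=> /andP[s0 sl]; rewrite -f0; apply: path_in_component => // u hu; apply: good; slra.
apply: contrapT => N.
pose m := (59 * #|` G|)%N.
pose s := [seq f (dl * (i%:R / m.+1%:R)) | i <- iota 0 m.+1].
have m0 : 0 < m.+1%:R :> R by rewrite ltr0n.
have range i : (i < m.+1)%N -> 0 <= dl * (i%:R / m.+1%:R) <= dl.
  move=> im; apply/andP; split; first by rewrite mulr_ge0 ?divr_ge0 ?ler0n// ltW.
  by rewrite -[leRHS]mulr1 ler_pM2l// ler_pdivrMr// mul1r ler_nat ltnW.
have us : uniq s.
  rewrite map_inj_in_uniq ?iota_uniq// => i j; rewrite !mem_iota !add0n /= => /range hi /range hj.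
  move=> /(ray_inj_dir r0 r0)[_ /dir_close].
  rewrite (_ : _ - _ = dl * (i%:R / m.+1%:R) - dl * (j%:R / m.+1%:R)); last by ring.
  move=> /(_ (small _ _ hi hj))/addrI/(mulfI (lt0r_neq0 dl0)) /(mulIf _).
  by rewrite invr_eq0 gt_eqF// => /(_ isT)/eqP; rewrite eqr_nat => /eqP.
have := size_nongeneric g0G us.
rewrite size_map size_iota ltnn => H; suff: false by []; apply: H.
move=> q /mapP[i]; rewrite mem_iota add0n /= => /range hi ->.
split; first by case: (good _ hi).
by move=> gq; apply: N; exists (f (dl * (i%:R / m.+1%:R))) => //; exact: comp.
Qed.


Lemma edge_mem_eq E E' x : edges A E -> edges A E' -> E x -> E' x -> E = E'.
Proof.
move=> [p Sp <-] [p' Sp' <-] x1 x2.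
by rewrite (same_connected_component x1) (same_connected_component x2).
Qed.

Definition edge_arc (E : set (R * R)) g h t v :=
  t < v /\ forall u, t <= u < v ->
    [/\ tight Th G g h u, generic Th G (apex Th g h u) & E (apex Th g h u)].

(** From a generic point of the edge the cone rotates until tightness or genericity is lost, at the
    latest after half a turn. *)
Lemma edge_arc_exists g0 E : g0 \in G -> edges A E -> exists g h t v,
  edge_arc E g h t v /\
  (~ tight Th G g h v \/ tight Th G g h v /\ ~ generic Th G (apex Th g h v)).
Proof.
move=> g0G [p Sp <-].
have [q cq Gq] := component_generic g0G Sp.
have [g [h [t [T aE]]]] := generic_tight Gq.
pose Q u := tight Th G g h u /\ generic Th G (apex Th g h u).
have oQ u : Q u -> \forall w \near u, Q w.
  by move=> [Tu Gu]; exact: (generic_near Thge Thpi Gu Tu erefl).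
have Qt : Q t by split=> //; rewrite aE.
have Qpi : ~ Q (t + pi).
  move=> [[_ _ + _ _] _]; case: T => _ _ + _ _.
  by rewrite /side cosDpi sinDpi; lra.
have tpi : t < t + pi by rewrite ltrDl pi_gt0.
have [v tv [Qv nQv]] := walk oQ Qt tpi Qpi.
exists g, h, t, v; split; last first.
  have [Tv|] := pselect (tight Th G g h v); last by left.
  by right; split=> // Gv; apply: nQv.
split=> // u hu; have [Tu Gu] := Qv u hu; split=> //.
rewrite (same_connected_component cq) -aE.
apply: path_in_component; first by case/andP: hu.
  by move=> w; exact: apex_cont.
by move=> w hw; apply: generic_arc; apply: (Qv w _).2; slra.
Qed.

Lemma edge_arc_shift E g h t v v' : same_dir v v' -> edge_arc E g h t v ->
  edge_arc E g h (t + (v' - v)) v'.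
Proof.
move=> d [tv H]; split; first by lra.
move=> u hu; have du : same_dir (u + (v - v')) u.
  have := dirD (u - v') d.
  have -> : v + (u - v') = u + (v - v') by ring.
  by have -> : v' + (u - v') = u by ring.
have [|T Gu Eu] := H (u + (v - v')); first by slra.
by rewrite -(dir_apex _ _ _ du); split=> //; exact: (dir_tight du).
Qed.

(** From the later of the two starts on, both arcs run through the same apexes, which thus lie in
    both components. *)
Lemma edge_arc_uniq E E' g h t t' v v' : edges A E -> edges A E' -> same_dir v v' ->
  edge_arc E g h t v -> edge_arc E' g h t' v' -> E = E'.
Proof.
move=> eE eE' d H /(edge_arc_shift (dir_sym d)) H'.
case: H H' => tv H [tv' H'].
pose m := Num.max t (t' + (v - v')).
have [|_ _ Em] := H m; first by rewrite le_max lexx gt_max tv tv'.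
have [|_ _ Em'] := H' m; first by rewrite le_max lexx orbT gt_max tv tv'.
exact: edge_mem_eq eE eE' Em Em'.
Qed.

(** Edges whose arc ends by losing tightness are charged to keys, [12] per guard. Any other arc ends
    at a non-generic point outside [G]; this point and the quadrant of the cone determine the edge,
    which gives [58 * 4] per guard. *)
Lemma size_edges g0 (s : seq (set (R * R))) : g0 \in G -> uniq s ->
  (forall E, E \in s -> edges A E) -> (size s <= 244 * #|` G|)%N.
Proof.
move=> g0G us Hs.
pose Z := [set p | boundary A p /\ p \notin G /\ ~ generic Th G p].
have Zle (z : seq (R * R)) : uniq z -> (forall x, x \in z -> Z x) -> (size z <= 58 * #|` G|)%N.
  move=> uz Hz; apply: (size_special Thge Thpi g0G uz) => p /Hz[b [n ng]].
  by split.
have finZ : finite_set Z.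
  apply: contrapT => /(@infinite_set_fset _ _ (58 * #|` G|).+1)[B BZ mB].
  have := Zle (enum_fset B) (fset_uniq B) (fun x xB => BZ x xB).
  by rewrite leqNgt mB.
pose zs := enum_fset (fset_set Z).
have zsP x : (x \in zs) = (x \in Z) by rewrite in_fset_set.
have zs58 : (size zs <= 58 * #|` G|)%N.
  apply: Zle; first exact: fset_uniq.
  by move=> x; rewrite zsP inE.
pose Q1 E kap := edges A E /\ exists g h t v,
  [/\ edge_arc E g h t v, arc_end Th G g h t v & key_rel Th G kap g h v].
pose Q2 E (y : (R * R) * nat) := edges A E /\ exists g h t v,
  [/\ edge_arc E g h t v, tight Th G g h v, apex Th g h v = y.1 & quad y.2 v].
pose d E := `[< exists2 kap, kap \in keys G & Q1 E kap >].
have -> : size s = (size (seq.filter d s) + size (seq.filter (predC d) s))%N.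
  by rewrite !size_filter count_predC.
have -> : (244 * #|` G| = 12 * #|` G| + 58 * #|` G| * 4)%N by lia.
apply: leq_add.
  rewrite -size_keys; apply: (@size_rel_in _ _ Q1); first by rewrite filter_uniq.
    by move=> E; rewrite mem_filter => /andP[/asboolP].
  move=> E E' kap _ _ [eE [g [h [t [v [H Ae K]]]]]] [eE' [g' [h' [t' [v' [H' Ae' K']]]]]].
  have [gg hh dv _] := key_inj Thge Thpi Ae Ae' K K'.
  rewrite -gg -hh in H'; exact: edge_arc_uniq eE eE' dv H H'.
pose D := allpairs pair zs (iota 0 4).
apply: (@leq_trans (size D)); last by rewrite size_allpairs size_iota leq_mul2r zs58 orbT.
apply: (@size_rel_in _ _ Q2); first by rewrite filter_uniq.
  move=> E; rewrite mem_filter => /andP[/= /asboolP nd /Hs eE].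
  have [g [h [t [v [[tv H] C]]]]] := edge_arc_exists g0G eE.
  have [Tv ng] : tight Th G g h v /\ ~ generic Th G (apex Th g h v).
    case: C => // nT; exfalso; apply: nd.
    have Ae : arc_end Th G g h t v by split=> // u /H[].
    have [kap kk K] := arc_end_key Thge Thpi Ae.
    by exists kap => //; split=> //; exists g, h, t, v.
  (* The end of the arc is a limit of boundary points. *)
  have bv : boundary A (apex Th g h v).
    apply: contrapT => nb.
    have oC : open (~` boundary A) by apply: closed_openC; exact: boundary_closed.
    have nC : nbhs (apex Th g h v) (~` boundary A) by apply: open_nbhs_nbhs.
    have [u hu] := near_below tv (@apex_cont R Th g h v _ nC).
    by have [_ [? _ _ _] _] := H u hu.
  have [j j4 qj] := quad_exists v.
  exists (apex Th g h v, j); last by split=> //; exists g, h, t, v.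
  rewrite /D; apply/allpairsP; exists (apex Th g h v, j); split=> //=.
  by rewrite zsP inE; split=> //; split=> //; exact: (tight_apex_notin Thge Thpi Tv).
move=> E E' [z j] _ _ [eE [g [h [t [v [H T aE q]]]]]] [eE' [g' [h' [t' [v' [H' T' aE' q']]]]]].
have [[r r0 hE] _] := tight_rays Thge Thpi T; have [[r' r0' hE'] _] := tight_rays Thge Thpi T'.
have ev := tight_emp Thge Thpi T; have ev' := tight_emp Thge Thpi T'.
rewrite aE in hE ev; rewrite aE' in hE' ev'.
have [_ hG _ _ _] := T; have [_ hG' _ _ _] := T'.
have dv : same_dir v v' := gap_start_uniq Thge Thpi ev ev' hG hG' r0 r0' hE hE' (quad_cos q q').
have [gg hh] : g = g' /\ h = h'.
  apply: (tight_pair_uniq Thge Thpi T (dir_tight (dir_sym dv) T')).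
  by rewrite aE -aE'; apply: dir_apex; exact: dir_sym.
rewrite -gg -hh in H'; exact: edge_arc_uniq eE eE' dv H H'.
Qed.

End Edges.

Unset Implicit Arguments.
Local Close Scope classical_set_scope.

Theorem theorem3 (R : realType) :
  exists K : nat,
    forall (n : nat) (G : {fset (R * R)}) (Theta : R),
      (1 <= n)%N -> #|` G|%fset = n ->
      pi / 2 <= Theta -> Theta < pi ->
      (complexity (theta_region G Theta) <= (K * n)%:R%:E)%E.
Proof.
(* [59] per guard for the vertices and [244] for the edges. *)
exists 303%N => n G Th n1 Gn Thge Thpi.
have [g0 g0G] : exists g0, g0 \in G.
  by apply/fset0Pn; rewrite -cardfs_gt0 Gn.
have -> : (303 * n = 59 * n + 244 * n)%N by lia.
rewrite natrD EFinD /complexity; apply: leeD; apply: counting_le => s us Hs; rewrite -Gn.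
  exact: (size_vertices Thge Thpi g0G us Hs).
exact: (size_edges Thge Thpi g0G us Hs).
Qed.
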